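(* Let $K$ be a field and let $\mathcal{P}$ be a polyomino. If there exists a cell $A$ in $\mathcal{P}$ such that $\mathcal{P}\setminus\{A\}$ is simple, then $\mathrm{height}(I_{\mathcal{P}})=|\mathcal{P}|$, where $|\mathcal{P}|$ is the number of cells of $\mathcal{P}$. In particular, $\mathrm{height}(I_{\mathcal{P}})=|\mathcal{P}|$ holds for every closed path polyomino $\mathcal{P}$.
   Context: Intervals and cells: for $a=(i,j)\le b=(k,l)$ in $\mathbb{Z}^2$ (componentwise order), $[a,b]=\{(m,n)\in\mathbb{Z}^2: i\le m\le k,\ j\le n\le l\}$. If $i<k$ and $j<l$ it is a proper interval, with diagonal corners $a,b$ and anti-diagonal corners $(i,l),(k,j)$; its vertex set consists of these four corners, and its edges are its four sides. A cell is an interval $[a,a+(1,1)]$. A path of cells is a sequence of distinct cells in which consecutive cells share an edge. A polyomino is a non-empty finite set $\mathcal{P}$ of cells such that any two of its cells are joined by a path of cells of $\mathcal{P}$. A collection of cells $\mathcal{P}$ is simple if any two cells of $\mathbb{Z}^2$ not in $\mathcal{P}$ are joined by a path of cells not in $\mathcal{P}$. $V(\mathcal{P})$ is the set of all vertices of cells of $\mathcal{P}$. An inner interval of $\mathcal{P}$ is a proper interval $I$ such that every cell contained in $I$ belongs to $\mathcal{P}$. Ideal: $S_{\mathcal{P}}=K[x_a: a\in V(\mathcal{P})]$, and $I_{\mathcal{P}}\subset S_{\mathcal{P}}$ is generated by the binomials $x_ax_b-x_cx_d$ for all inner intervals $[a,b]$ of $\mathcal{P}$, with $a,b$ the diagonal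 and $c,d$ the anti-diagonal corners. Closed path: a polyomino $\mathcal{P}=\{A_1,\dots,A_n\}$ with $n>5$, the $A_i$ pairwise distinct, such that (indices mod $n$) $A_i\cap A_{i+1}$ is a common edge for all $i$, and $V(A_i)\cap V(A_j)=\emptyset$ whenever $j\notin\{i-2,i-1,i,i+1,i+2\}$. *)

(* Defs.v *)
From HB Require Import structures.
From mathcomp Require Import all_boot all_order all_algebra.
From mathcomp Require Import boolp classical_sets.
From mathcomp Require Import finmap.
From mathcomp Require Import mpoly.

Set Implicit Arguments.
Unset Strict Implicit.
Unset Printing Implicit Defensive.

Local Open Scope fset_scope.
Local Open Scope ring_scope.

Definition point : Type := (int * int)%type.

Definition itv (a b : point) : {pred point} :=
  [pred x : point | (a.1 <= x.1 <= b.1) && (a.2 <= x.2 <= b.2)].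

Definition proper_itv (a b : point) : bool := (a.1 < b.1) && (a.2 < b.2).

Definition itv_vertices (a b : point) : {fset point} :=
  [fset a; b; (a.1, b.2); (b.1, a.2)].

Definition itv_edges (a b : point) : {fset {fset point}} :=
  [fset [fset a; (b.1, a.2)]; [fset (a.1, b.2); b];
        [fset a; (a.1, b.2)]; [fset (b.1, a.2); b]].

(* The cell [a, a + (1, 1)] is encoded by its lower left corner a. *)
Definition cell : Type := point.

Definition cell_ur (c : cell) : point := (c.1 + 1, c.2 + 1).

(* A cell has no lattice points besides its corners, so this is also the set
   of all lattice points of the cell. *)
Definition cell_vertices (c : cell) : {fset point} := itv_vertices c (cell_ur c).

Definition cell_edges (c : cell) : {fset {fset point}} := itv_edges c (cell_ur c).

Definition share_edge : rel cell := fun c d =>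
  (cell_vertices c `&` cell_vertices d \in cell_edges c)
  && (cell_vertices c `&` cell_vertices d \in cell_edges d).

Definition cell_path_in (Q : {pred cell}) (c d : cell) : Prop :=
  exists s : seq cell,
    [/\ uniq (c :: s), path share_edge c s, last c s = d
      & {subset c :: s <= Q}].

Definition is_polyomino (P : {fset cell}) : Prop :=
  P != fset0 /\ {in P &, forall c d, cell_path_in (mem P) c d}.

Definition is_simple (P : {fset cell}) : Prop :=
  forall c d : cell, c \notin P -> d \notin P -> cell_path_in [predC P] c d.

Definition vertices (P : {fset cell}) : {fset point} :=
  \bigcup_(c <- P) cell_vertices c.

Definition inner_itv (P : {fset cell}) (a b : point) : Prop :=
  proper_itv a b /\
  forall c : cell, {subset itv c (cell_ur c) <= itv a b} -> c \in P.

Definition is_closed_path (P : {fset cell}) : Prop :=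
  is_polyomino P /\
  exists (n : nat) (A : 'I_n -> cell),
    [/\ (5 < n)%N, injective A, P = [fset A i | i : 'I_n],
        forall i, share_edge (A i) (A (ordS i))
      & forall i j,
          j \notin [:: ord_pred (ord_pred i); ord_pred i; i;
                       ordS i; ordS (ordS i)] ->
          cell_vertices (A i) `&` cell_vertices (A j) = fset0].

Definition ideal_gen (R : comNzRingType) (G : set R) : set R :=
  fun x => exists s : seq (R * R),
    (forall rg, rg \in s -> G rg.2) /\ x = \sum_(rg <- s) rg.1 * rg.2.

(* [idealr_closed] includes 1 \notin p. *)
Definition is_prime_ideal (R : comNzRingType) (p : set R) : Prop :=
  idealr_closed (mem p) /\ prime_idealr_closed (mem p).

Definition prime_chain (R : comNzRingType) (n : nat) (q : nat -> set R) : Prop :=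
  (forall i, (i <= n)%N -> is_prime_ideal (q i)) /\
  (forall i, (i < n)%N -> (q i `<` q i.+1)%classic).

Definition has_prime_height (R : comNzRingType) (p : set R) (n : nat) : Prop :=
  (exists q, prime_chain n q /\ q n = p) /\
  (forall m q, prime_chain m q -> q m = p -> (m <= n)%N).

(* height I = n: the minimum of the heights of the primes containing I is
   attained and equals n.  A prime of infinite height satisfies
   [has_prime_height] for no m, and so never bounds the minimum. *)
Definition has_height (R : comNzRingType) (I : set R) (n : nat) : Prop :=
  (exists p, [/\ is_prime_ideal p, (I `<=` p)%classic & has_prime_height p n])
  /\ (forall p m, is_prime_ideal p -> (I `<=` p)%classic ->
        has_prime_height p m -> (n <= m)%N).

Definition polyomino_ring (K : fieldType) (P : {fset cell}) : comNzRingType :=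
  {mpoly K[#|{: vertices P}|]}.

(* The indeterminate x_a; the variables are numbered along the enumeration of
   the finite type of vertices of P. *)
Definition x_ (K : fieldType) (P : {fset cell}) (a : vertices P) :
    polyomino_ring K P :=
  'X_(enum_rank a).

(* The corners of an inner interval always belong to [vertices P], so
   quantifying over vertices here loses no inner interval. *)
Definition inner_2minors (K : fieldType) (P : {fset cell}) :
    set (polyomino_ring K P) :=
  fun f => exists a b c d : vertices P,
    [/\ inner_itv P (val a) (val b),
        val c = ((val a).1, (val b).2), val d = ((val b).1, (val a).2)
      & f = x_ K a * x_ K b - x_ K c * x_ K d].

Definition polyomino_ideal (K : fieldType) (P : {fset cell}) :
    set (polyomino_ring K P) :=
  ideal_gen (@inner_2minors K P).

Arguments polyomino_ideal : clear implicits.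

(* Main.v *)
(* A prime p containing I_P has height n - |T| for every maximal set T of
   variables independent modulo p, where n = |V(P)|, so the lower bound amounts
   to |T| <= n - |P|.  Let x_v be the residues of the variables in the fraction
   field of S/p.

   If no x_v vanishes, then the 2-minors of the cells give |P| multiplicatively
   independent relations between the x_v, and the bound is linear algebra.
   If x_a = 0, let Q be P without the cell A; by linear algebra again, if T were
   larger then some nonzero combination w of the 2-minor exponent vectors of the
   cells of Q would be supported on T and a.  It yields a closed walk along
   horizontal and vertical lines of Q, whose corners alternate between positive
   and negative entries of that vector.  Since Q has no holes, the
   product of the x_v over the first kind of vertices equals the product over
   the second kind (cut the walk along chords down to rectangles).  So either
   the variables of T satisfy a relation or a product of nonzero x_v is 0.

   For the upper bound, the kernel of a toric parametrization of P contains I_P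
   and leaves n - |P| variables independent; a chain of m primes below it makes
   n - |P| + m algebraically independent polynomials in n variables. *)
From HB Require Import structures.
From mathcomp Require Import all_boot all_order all_algebra.
From mathcomp Require Import boolp classical_sets.
From mathcomp Require Import finmap mpoly.
From mathcomp Require Import zify ring.
Require Import Defs.

Set Implicit Arguments.
Unset Strict Implicit.
Unset Printing Implicit Defensive.

Import Order.TTheory GRing.Theory Num.Theory.

Local Open Scope fset_scope.
Local Open Scope ring_scope.

(** * Extrema of bounded sets of integers *)

Lemma int_max (A : int -> Prop) (N z : int) :
  A z -> (forall t, A t -> t <= N) ->
  exists2 m, A m & forall t, A t -> t <= m.
Proof.
move=> Az leN; pose B n := `[< A (N - n%:Z) >].
have exB : exists n, B n.
  exists `|N - z|%N; apply/asboolP.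
  by rewrite (_ : N - _ = z) //; have := leN _ Az; lia.
case: (ex_minnP exB) => n /asboolP An min_n; exists (N - n%:Z) => // t At.
have := leN _ At => le_tN; have /min_n : B `|N - t|%N.
  by apply/asboolP; have -> : N - `|N - t|%N%:Z = t by lia.
lia.
Qed.

Lemma int_min (A : int -> Prop) (N z : int) :
  A z -> (forall t, A t -> N <= t) ->
  exists2 m, A m & forall t, A t -> m <= t.
Proof.
move=> Az geN; have [||m Am max_m] := @int_max (fun t => A (- t)) (- N) (- z).
- by rewrite opprK.
- by move=> t /geN; lia.
by exists (- m) => // t At; have := max_m (- t); rewrite opprK => /(_ At); lia.
Qed.

(** * Segments along lattice lines and closed walks *)

Section Lines.

Variable Q : {fset cell}.

(** The integer [t] stands for the unit step from [t] to [t + 1]; the bounds [a] and [b] may come in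
    either order. *)
Definition all_between (E : int -> bool) (a b : int) : bool :=
  `[< forall t, (a <= t < b) || (b <= t < a) -> E t >].

(** Every unit edge of the segment from [p] to [q] is a side of a cell of [Q] above or below it. *)
Definition hconn : rel point := fun p q =>
  (p.2 == q.2) &&
  all_between (fun t => ((t, p.2) \in Q) || ((t, p.2 - 1) \in Q)) p.1 q.1.

Definition vconn : rel point := fun p q =>
  (p.1 == q.1) &&
  all_between (fun t => ((p.1, t) \in Q) || ((p.1 - 1, t) \in Q)) p.2 q.2.

Lemma all_betweenC E a b : all_between E a b = all_between E b a.
Proof. by apply/asboolP/asboolP => H t ht; apply: H; rewrite orbC. Qed.

Lemma all_between_trans E a b c :
  all_between E a b -> all_between E b c -> all_between E a c.
Proof.
move=> /asboolP Hab /asboolP Hbc; apply/asboolP => t ht.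
have [h|h] := boolP ((a <= t < b) || (b <= t < a)); first exact: Hab.
by apply: Hbc; lia.
Qed.

Lemma hconnC : ssrbool.symmetric hconn.
Proof.
by move=> p q; rewrite /hconn eq_sym; case: eqP => //= ->; rewrite all_betweenC.
Qed.

Lemma vconnC : ssrbool.symmetric vconn.
Proof.
by move=> p q; rewrite /vconn eq_sym; case: eqP => //= ->; rewrite all_betweenC.
Qed.

Lemma hconn_trans : transitive hconn.
Proof.
move=> q p r /andP[/eqP e1 h1] /andP[/eqP e2 h2]; apply/andP; split.
  by rewrite e1 e2.
by apply: all_between_trans h1 _; rewrite e1.
Qed.

Lemma vconn_trans : transitive vconn.
Proof.
move=> q p r /andP[/eqP e1 h1] /andP[/eqP e2 h2]; apply/andP; split.
  by rewrite e1 e2.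
by apply: all_between_trans h1 _; rewrite e1.
Qed.

(** Only the vertical segments are stored; a horizontal one joins the end of each to the beginning
    of the next, cyclically. *)
Definition closed_walk (s : seq (point * point)) : bool :=
  all (fun e => vconn e.1 e.2) s && cycle (fun e f => hconn e.2 f.1) s.

Lemma closed_walk_rot n s : closed_walk (rot n s) = closed_walk s.
Proof. by rewrite /closed_walk (eq_all_r (mem_rot n s)) rot_cycle. Qed.

End Lines.

(** A failing pair is rotated to the front; in a cycle of length one, [head e r] is [e] itself. *)
Lemma cycle_jumpP (T : Type) (R : rel T) (s : seq T) :
  ~~ cycle R s ->
  exists n e r, rot n s = e :: r /\ ~~ R e (head e r).
Proof.
have aux x p : ~~ path R x p ->
    exists p1 y p2, p = p1 ++ y :: p2 /\ ~~ R (last x p1) y.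
  elim: p x => //= y p IHp x; have [Rxy /= /IHp | nRxy _] := boolP (R x y).
    by case=> p1 [z [p2 [-> nR]]]; exists (y :: p1), z, p2.
  by exists [::], y, p.
case: s => // x s /aux[p1 [y [p2 [Es]]]].
case/lastP: p2 Es => [|p2 z].
  rewrite cats1 => /rcons_inj[-> ->].
  case/lastP: p1 => [|p1 z]; first by exists 0%N, y, [::]; rewrite rot0.
  rewrite last_rcons => nR; exists (size p1).+1, z, (y :: p1).
  by split=> //; have := rot_size_cat (y :: p1) [:: z]; rewrite /= cats1.
rewrite -rcons_cons -rcons_cat => /rcons_inj[-> _].
case/lastP: p1 => [|p1 u]; first by exists 0%N, x, (y :: p2); rewrite rot0.
rewrite last_rcons => nR; exists (size p1).+1, u, (y :: p2 ++ x :: p1).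
split=> //; have := rot_size_cat (x :: p1) (u :: y :: p2).
by rewrite /= -cat_rcons.
Qed.

(** Each second point is matched with the first point that follows it in the cycle. *)
Lemma cycle_sum (V : nmodType) (T : Type) (G : T -> V) (R : rel (T * T)) s :
  (forall e f, R e f -> G e.2 = G f.1) -> cycle R s ->
  \sum_(e <- s) G e.2 = \sum_(e <- s) G e.1.
Proof.
move=> RG; case: s => [|x s]; first by rewrite !big_nil.
have aux y p z : path R y (rcons p z) ->
    \sum_(e <- y :: p) G e.2 = \sum_(e <- rcons p z) G e.1.
  elim: p y => [|u p IHp] y /=; first by rewrite andbT !big_seq1 => /RG.
  by case/andP=> /RG Ryu /IHp; rewrite big_cons Ryu => ->; rewrite big_cons.
by move=> /aux ->; rewrite big_rcons big_cons addrC.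
Qed.

(** * Winding numbers of closed walks *)

Section Winding.

(** Its increment along a vertical segment counts, with sign, the crossing of the ray that leaves
    the centre of the cell [c] to the right. *)
Definition quadrant (c p : point) : int := ((c.1 < p.1) && (c.2 < p.2) : nat).

(* The winding number around the cell [c] of the closed lattice curve running
   alternately through the vertical segments [e.1, e.2] and the horizontal
   segments from [e.2] to the next [f.1]. *)
Definition winding (s : seq (point * point)) (c : cell) : int :=
  \sum_(e <- s) (quadrant c e.2 - quadrant c e.1).

Lemma sum_neq0 (V : nmodType) (T : eqType) (s : seq T) (F : T -> V) :
  \sum_(e <- s) F e != 0 -> exists2 e, e \in s & F e != 0.
Proof.
move=> n0; apply/hasP; apply: contraNT n0; rewrite -all_predC => /allP F0.
by rewrite big_seq big1 // => e /F0 /=; rewrite negbK => /eqP.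
Qed.

(** Summed with alternating signs over the four cells around [v], [quadrant] becomes the indicator
    of the point [v]. *)
Lemma winding_corner s v :
  winding s (v.1 - 1, v.2 - 1) - winding s (v.1, v.2 - 1)
    - winding s (v.1 - 1, v.2) + winding s v
  = \sum_(e <- s) ((e.2 == v : nat)%:Z - (e.1 == v : nat)%:Z).
Proof.
rewrite /winding -!sumrB -big_split /=; apply: eq_bigr => -[[p1 p2] [q1 q2]] _.
by case: v => v1 v2; rewrite /quadrant /= !xpair_eqE; lia.
Qed.

Variables (Q : {fset cell}) (s : seq (point * point)).
Hypothesis walk_s : closed_walk Q s.

(** A change across the right side of [c] comes from a vertical segment of the walk that runs along
    this side. *)
Lemma winding_right c :
  winding s c != winding s (c.1 + 1, c.2) ->
  (c \in Q) || ((c.1 + 1, c.2) \in Q).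
Proof.
rewrite -subr_eq0 -sumrB => /sum_neq0[[[p1 p2] [q1 q2]] se].
case/andP: walk_s => /allP/(_ _ se) + _; case: c => c1 c2.
rewrite /vconn /quadrant /= => /andP[/eqP <- /asboolP H].
case: (eqVneq p1 (c1 + 1)) => [e|ne]; last by lia.
by move=> ?; rewrite orbC -e -[in (c1, _)](addrK 1 c1) -e; apply: H; lia.
Qed.

Lemma winding_up c :
  winding s c != winding s (c.1, c.2 + 1) ->
  exists n e r, [/\ rot n s = e :: r, hconn Q e.2 (c.1, c.2 + 1),
   hconn Q e.2 (head e r).1 & (c \in Q) || ((c.1, c.2 + 1) \in Q)].
Proof.
(* [G] is the indicator of the half-line that starts at the upper right corner of [c] and runs to
   the right. If it agreed at both ends of every horizontal segment, its increments would cancel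
   around the walk; so some horizontal segment runs along the top side of [c]. *)
pose G (p : point) : int := quadrant c p - quadrant (c.1, c.2 + 1) p.
move=> nw; have /cycle_jumpP[n [e [r [rs nG]]]] :
    ~~ cycle (fun e f => G e.2 == G f.1) s.
  apply: contraNN nw => cyc; rewrite -subr_eq0 -sumrB.
  have := cycle_sum (fun e f => @eqP _ (G e.2) (G f.1)) cyc.
  move=> E; rewrite (eq_bigr (fun e => G e.2 - G e.1)).
    by rewrite sumrB E subrr.
  by move=> e _; rewrite /G; ring.
exists n, e, r; move: walk_s; rewrite -(closed_walk_rot _ n) rs => /andP[_].
have h12 : cycle (fun e f : point * point => hconn Q e.2 f.1) (e :: r) ->
    hconn Q e.2 (head e r).1 by case: (r) => [|f r'] /= /andP[].
move=> /h12 H; have := H; move: nG; rewrite /G /quadrant /hconn.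
case: c {nw G} => c1 c2; case: (e.2) => p1 p2; case: (head e r).1 => q1 q2 /=.
move=> nG /andP[/eqP eq_pq /asboolP Hpq]; move: nG Hpq; rewrite -eq_pq.
case: (eqVneq p2 (c2 + 1)) => [->|?]; last by lia.
rewrite addrK => nG Hpq; split=> //.
- by apply/asboolP => t ht; apply: Hpq; lia.
- by rewrite eqxx /=; apply/asboolP.
- by rewrite orbC; apply: Hpq; lia.
Qed.

Lemma winding_bounded :
  exists N : int, forall c, winding s c != 0 -> (`|c.1| < N) && (`|c.2| < N).
Proof.
have [N bN] : exists N : int, forall e, e \in s ->
    [&& `|e.1.1| < N, `|e.1.2| < N, `|e.2.1| < N & `|e.2.2| < N].
  elim: (s) => [|[[e1 e2] [e3 e4]] l [N bN]]; first by exists 0.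
  exists (`|N| + `|e1| + `|e2| + `|e3| + `|e4| + 1) => -[[f1 f2] [f3 f4]].
  by rewrite inE => /predU1P[[-> -> -> ->]|/bN] /=; lia.
have N_ge c : winding s c != 0 -> 0 <= N.
  by case/sum_neq0=> e /bN; lia.
exists (N + 1) => c nw; have := N_ge c nw; move: nw.
(* To the left of the walk [quadrant] depends on the row alone, and rows do not change along
   horizontal segments, so the sum telescopes. In the other three directions every term vanishes. *)
case: c => c1 c2; case: (ltP c1 (- N)) => hc1.
  rewrite (_ : winding s _ = 0) ?eqxx //.
  pose G (p : point) : int := ((c2 < p.2)%R : nat).
  transitivity (\sum_(e <- s) (G e.2 - G e.1)).
    rewrite /winding big_seq [RHS]big_seq; apply: eq_bigr => -[[? ?] [? ?]] /bN.
    by rewrite /quadrant /G /=; lia.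
  rewrite sumrB (@cycle_sum _ _ G (fun e f => hconn Q e.2 f.1)) ?subrr //.
    by move=> e f /andP[/eqP]; rewrite /G => ->.
  by case/andP: walk_s.
case/sum_neq0=> -[[? ?] [? ?]] se; have := bN _ se.
case/andP: walk_s => /allP/(_ _ se).
by rewrite /vconn /quadrant /= => /andP[/eqP + _] _; lia.
Qed.

End Winding.

(** * Collections without holes and the product rule for closed walks *)

Section AcyclicCollections.

Definition cell_adj (c d : cell) : bool := `|c.1 - d.1| + `|c.2 - d.2| == 1.

Lemma cell_adjP (a b c d : int) : cell_adj (a, b) (c, d) ->
  [\/ c = a + 1 /\ d = b, a = c + 1 /\ d = b, c = a /\ d = b + 1
    | c = a /\ b = d + 1].
Proof.
move=> /eqP /= E; have [lt_ac|lt_ca|eq_ac] := ltgtP a c.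
- by apply: Or41; split; lia.
- by apply: Or42; split; lia.
have [lt_bd|lt_db|eq_bd] := ltgtP b d.
- by apply: Or43; split; lia.
- by apply: Or44; split; lia.
by lia.
Qed.

(* The complement of [Q] has no bounded component: a closed lattice curve made
   of edges of cells of [Q] winds around no cell outside [Q]. *)
Definition acyclic (Q : {fset cell}) : Prop :=
  forall w : cell -> int,
    (exists N : int, forall c, w c != 0 -> (`|c.1| < N) && (`|c.2| < N)) ->
    (forall c d, cell_adj c d -> c \notin Q -> d \notin Q -> w c = w d) ->
  forall c, c \notin Q -> w c = 0.

(** The values [x] annihilate the 2-minors of all inner intervals of [Q]. Cells are given by their
    lower left corners, hence the strict upper bounds. *)
Definition rectangle_rule (Q : {fset cell}) (R : pzSemiRingType)
    (x : point -> R) : Prop :=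
  forall i k y l : int, i < k -> y < l ->
    (forall c : cell, i <= c.1 < k -> y <= c.2 < l -> c \in Q) ->
  x (i, y) * x (k, l) = x (i, l) * x (k, y).

Lemma acyclic_winding (Q : {fset cell}) s c :
  acyclic Q -> closed_walk Q s -> c \notin Q -> winding s c = 0.
Proof.
move=> aQ ws; apply: aQ; first exact: winding_bounded ws.
have right a b : (a, b) \notin Q -> (a + 1, b) \notin Q ->
    winding s (a, b) = winding s (a + 1, b).
  move=> cQ cQ'; apply/eqP; apply: contraTT cQ => /(winding_right ws).
  by rewrite (negbTE cQ') orbF negbK.
have up a b : (a, b) \notin Q -> (a, b + 1) \notin Q ->
    winding s (a, b) = winding s (a, b + 1).
  move=> cQ cQ'; apply/eqP; apply: contraTT cQ => /(winding_up ws).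
  by case=> n [e [r [_ _ _]]]; rewrite (negbTE cQ') orbF negbK.
move=> [c1 c2] [d1 d2] /cell_adjP[] [? ?] cQ dQ; subst.
- exact: right.
- exact/esym/right.
- exact: up.
- exact/esym/up.
Qed.

Section WalkRule.

Variables (Q : {fset cell}) (R : comPzRingType) (x : point -> R).
Hypothesis rect : rectangle_rule Q x.
Hypothesis winding_out :
  forall s c, closed_walk Q s -> c \notin Q -> winding s c = 0.

Definition balanced (s : seq (point * point)) : Prop :=
  \prod_(e <- s) x e.1 = \prod_(e <- s) x e.2.

Lemma balanced_rot n s : balanced (rot n s) -> balanced s.
Proof.
have E i : perm_eq (rot i s) s by rewrite perm_rot.
by rewrite /balanced !(perm_big _ (E n)).
Qed.

(** By [winding_corner] every point is a first point as often as a second point, so both products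
    have the same factors. *)
Lemma balanced_winding0 s : (forall c, winding s c = 0) -> balanced s.
Proof.
move=> w0; rewrite /balanced -(big_map fst predT) -(big_map snd predT).
apply/perm_big/allP => v _ /=; rewrite !count_map.
have C (f : point * point -> point) :
    count (preim f (pred1 v)) s = (\sum_(e <- s) (f e == v : nat))%N.
  by rewrite -sum1_count big_mkcond; apply: eq_bigr => e _ /=; case: eqP.
have := winding_corner s v; rewrite !w0 !subr0 ?addr0 sumrB => /esym/eqP.
by rewrite subr_eq0 -!(big_morph Posz PoszD (erefl _)) eqz_nat eq_sym !C.
Qed.

Definition endpoint (e : point * point) (v : point) : bool :=
  (e.1 == v) || (e.2 == v).

(** Above row [j] the winding number is zero, so [winding_corner] at [(i, j + 1)] reduces to the
    difference of the two values in row [j]. *)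
Lemma winding_top_corner s (i j : int) :
  (forall c, winding s c != 0 -> c.2 <= j) ->
  winding s (i - 1, j) != winding s (i, j) ->
  exists2 e, e \in s & endpoint e (i, j + 1).
Proof.
move=> top nw; have w0 t : winding s (t, j + 1) = 0.
  by apply/eqP; apply: contraTT isT => /top /=; lia.
have := winding_corner s (i, j + 1); rewrite /= addrK !w0 !subr0 ?addr0 => E.
have : winding s (i - 1, j) - winding s (i, j) != 0 by rewrite subr_eq0.
rewrite E => /sum_neq0[e se ne]; exists e => //; move: ne; rewrite /endpoint.
by case: (e.1 == _); case: (e.2 == _).
Qed.

(* A chord of the walk cuts it into two shorter closed walks. *)
Lemma balanced_chord e0 mid e1 post v :
  (forall s, (size s < size (e0 :: mid ++ e1 :: post))%N ->
     closed_walk Q s -> balanced s) ->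
  mid != [::] -> closed_walk Q (e0 :: mid ++ e1 :: post) ->
  hconn Q e0.2 v -> vconn Q e1.1 v -> balanced (e0 :: mid ++ e1 :: post).
Proof.
case: mid => // f mid IH _ ws h0 v1.
have [] : balanced (rcons (f :: mid) (e1.1, v)) /\
          balanced (e0 :: (v, e1.2) :: post).
  move: ws; rewrite /closed_walk /= !all_cat /= rcons_cat cat_path /=.
  case/andP=> /and5P[v0 vf vm ve1 vp] /and3P[hf hm /andP[hm1 hp]].
  split; apply: IH => /=; rewrite ?size_rcons ?size_cat ?addnS //=.
  - by rewrite !ltnS leq_addr.
  - rewrite /closed_walk /= all_rcons /= vf v1 vm /= rcons_path.
    rewrite rcons_path last_rcons /= hm hm1 /=.
    by rewrite (hconn_trans _ hf) // hconnC.
  - by rewrite !ltnS leq_addl.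
  - have hp' : path (fun e f : point * point => hconn Q e.2 f.1) (v, e1.2)
        (rcons post e0) by case: (post) hp.
    by rewrite /closed_walk /= v0 vp h0 hp' !andbT (vconn_trans _ ve1) //
      vconnC.
rewrite /balanced -cats1 !(big_cat, big_cons, big_nil) /= !mulr1.
move: (x f.1) (x f.2) (x e0.1) (x e0.2) (x e1.1) (x e1.2) (x v) =>
  f1 f2 a b c d u.
move: (\prod_(i <- mid) x i.1) (\prod_(i <- mid) x i.2) => m1 m2.
move: (\prod_(i <- post) x i.1) (\prod_(i <- post) x i.2) => p1 p2 H1 H2.
(* The value [u] at the cutting point is substituted and never cancelled, so it may be zero. *)
transitivity (a * p1 * (f1 * m1 * c)); first by ring.
rewrite H1; transitivity (f2 * m2 * (a * (u * p1))); first by ring.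
by rewrite H2; ring.
Qed.

Lemma hconn_inside i k y t :
  (forall t, i <= t < k -> (t, y) \in Q) -> i <= t <= k ->
  hconn Q (i, y) (t, y).
Proof. by move=> H ht; rewrite /hconn eqxx; apply/asboolP => /= u hu;
  rewrite H; lia. Qed.

Lemma vconn_inside z l y t :
  (forall t, y <= t < l -> ((z, t) \in Q) || ((z - 1, t) \in Q)) ->
  y <= t <= l -> vconn Q (z, t) (z, l).
Proof. by move=> H ht; rewrite /vconn eqxx; apply/asboolP => /= u hu;
  apply: H; lia. Qed.

(* Let [m] be the value of the winding number on a horizontal run [i, k) of
   its top row [j], and let [y] be the lowest row down to which the value
   above [i, k) is constantly [m].  The two top corners of this rectangle are
   vertices of the walk, and some horizontal segment of the walk is connected
   to its bottom side; the bottom corners provide chords. *)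
Lemma top_rectangle s :
  closed_walk Q s -> ~ (forall c, winding s c = 0) ->
  exists i k y j : int, [/\ i < k, y <= j,
    (forall c, i <= c.1 < k -> y <= c.2 <= j -> c \in Q),
    (exists2 e, e \in s & endpoint e (i, j + 1)) /\
    (exists2 e, e \in s & endpoint e (k, j + 1))
    & exists n e r, [/\ rot n s = e :: r, hconn Q e.2 (i, y) &
                        hconn Q e.2 (head e r).1]].
Proof.
move=> ws /existsNP[c0 /eqP nw0]; have [N bN] := winding_bounded ws.
have wQ c : winding s c != 0 -> c \in Q.
  by move=> nw; apply: contraNT nw => cQ; rewrite (winding_out ws cQ).
have [||j [a nwa] top] :=
  @int_max (fun t => exists a, winding s (a, t) != 0) N c0.2.
- by exists c0.1; rewrite -surjective_pairing.
- by move=> t [a /bN] /=; lia.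
have {}top c : winding s c != 0 -> c.2 <= j.
  by move=> nw; apply: top; exists c.1; rewrite -surjective_pairing.
set m := winding s (a, j) in nwa.
have [||i [le_ia mi] mini] := @int_min
  (fun i => i <= a /\ forall t, i <= t <= a -> winding s (t, j) = m) (- N) a.
- by split=> // t ht; rewrite (_ : t = a) //; lia.
- move=> t [le_ta mt]; have := bN (t, j); rewrite mt ?lexx // => /(_ nwa) /=.
  lia.
have [||k [lt_ak mk] maxk] := @int_max
  (fun k => a < k /\ forall t, a <= t < k -> winding s (t, j) = m) N (a + 1).
- by split=> [|t ht]; [lia | rewrite (_ : t = a) //; lia].
- move=> t [lt_at mt]; have := bN (t - 1, j); rewrite mt => [/(_ nwa) /=|].
    lia.
  lia.
have mj t : i <= t < k -> winding s (t, j) = m.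
  by move=> ht; case: (leP t a) => hta; [apply: mi | apply: mk]; lia.
have [||y [le_yj my] miny] := @int_min (fun y => y <= j /\
  forall c, i <= c.1 < k -> y <= c.2 <= j -> winding s c = m) (- N) j.
- split=> // -[c1 c2] /= h1 h2; rewrite (_ : c2 = j); last by lia.
  exact: mj.
- move=> t [le_tj mt]; have := bN (a, t); rewrite mt /= => [/(_ nwa)||] /=; lia.
have nwi : winding s (i - 1, j) != winding s (i, j).
  rewrite (mj i); last by lia.
  apply/eqP => E; suff : i <= i - 1 by lia.
  apply: mini; split=> [|t ht]; first by lia.
  by case: (eqVneq t (i - 1)) => [->//|?]; apply: mi; lia.
have nwk : winding s (k - 1, j) != winding s (k, j).
  rewrite (mj (k - 1)); last by lia.
  apply/eqP => E; suff : k + 1 <= k by lia.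
  apply: maxk; split=> [|t ht]; first by lia.
  by case: (eqVneq t k) => [->//|?]; apply: mk; lia.
(* Otherwise the next row below could be added, against the minimality of [y]. *)
have [t ht nwt] : exists2 t, i <= t < k & winding s (t, y - 1) != m.
  apply: contrapT => H; suff : y <= y - 1 by lia.
  apply: miny; split=> [|[c1 c2] /= h1 h2]; first by lia.
  case: (eqVneq c2 (y - 1)) => [->|?]; last by apply: my => /=; lia.
  by apply: contrapT => /eqP nE; apply: H; exists c1.
exists i, k, y, j; split=> //; first by lia.
- by move=> c h1 h2; apply: wQ; rewrite my.
- by split; apply: winding_top_corner.
have nwty : winding s (t, y - 1) != winding s (t, y - 1 + 1).
  by rewrite subrK [X in _ != X]my //=; lia.
have [n [e [r [rs h1 h2 _]]]] := winding_up ws nwty.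
exists n, e, r; split=> //; apply: hconn_trans h1 _; rewrite /= subrK hconnC.
apply: hconn_inside (k) _ _ _ _ => [u hu|]; last by lia.
by apply: wQ; rewrite my //=; lia.
Qed.

(** Induction on the number of vertical segments: either a bottom corner of the rectangle from
    [top_rectangle] gives a chord, or the walk runs around three sides of this rectangle, which is
    then cut off. *)
Lemma closed_walk_balanced s : closed_walk Q s -> balanced s.
Proof.
have [n] := ubnP (size s); elim: n s => // n IHn s /ltnSE le_sn ws.
have IH s' : (size s' < size s)%N -> closed_walk Q s' -> balanced s'.
  by move=> lt_s's; apply: IHn; apply: leq_trans le_sn.
have [w0|/top_rectangle] := pselect (forall c, winding s c = 0).
  exact: balanced_winding0.
case/(_ ws) => i [k [y [j [lt_ik le_yj inQ [[ei sei Ei] [ek sek Ek]]]]]].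
case=> g [e0 [r [rs h0 h0r]]].
move: sei sek; rewrite -(mem_rot g s) -(mem_rot g s) rs => sei sek.
apply: (@balanced_rot g); rewrite rs.
move: ws IH; rewrite -(closed_walk_rot Q g) -(size_rot g s) rs =>
  {rs s le_sn}ws IH.
have vconn_s e : e \in e0 :: r -> vconn Q e.1 e.2.
  by case/andP: ws => /allP H _ /H.
(* A vertical segment with an end at a top corner is connected to the bottom corner, along the side
   of the rectangle. *)
have corner z e : i <= z <= k -> e \in e0 :: r ->
    endpoint e (z, j + 1) -> vconn Q e.1 (z, y).
  move=> hz se hE; have hv : vconn Q (z, j + 1) (z, y).
    rewrite vconnC; apply: (vconn_inside (y := y)); last by lia.
    move=> t ht; case: (ltP z k) => hzk; first by rewrite inQ //=; lia.
    by rewrite orbC inQ //=; lia.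
  case/orP: hE => /eqP E; first by rewrite E.
  by apply: vconn_trans (vconn_s _ se) _; rewrite E.
(* Since [e0] ends on the line of the bottom side, the bottom corner cuts the walk between [e0] and
   [e], unless [e] is [e0] itself or its successor. *)
have cornerP z e : i <= z <= k -> e \in e0 :: r ->
    endpoint e (z, j + 1) ->
    balanced (e0 :: r) \/ (e = e0 \/ exists r2, r = e :: r2).
  move=> hz se hE; move: (se); rewrite inE => /predU1P[->|];
    first by right; left.
  move=> er; case/splitPr: r / er se ws IH h0r vconn_s sei sek corner.
  case=> [|f r1] r2 se ws IH h0r vconn_s sei sek corner.
    by right; right; exists r2.
  left; apply: (@balanced_chord _ (f :: r1) _ _ (z, y)) => //;
    last exact: corner.
  apply: hconn_trans h0 _; apply: hconn_inside hz => t ht.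
  by apply: inQ => /=; lia.
(* In the remaining case [e0] goes down one side of the rectangle and its successor [f] goes up the
   other one. *)
have main z z' f r2 : r = f :: r2 -> (z = i /\ z' = k) \/ (z = k /\ z' = i) ->
    endpoint e0 (z, j + 1) ->
    endpoint f (z', j + 1) -> balanced (e0 :: r).
  move=> Er hz; rewrite Er /= in h0r vconn_s ws IH *.
  have [y0 yf] : e0.2.2 = y /\ f.1.2 = y.
    by case/andP: h0 => /eqP y0 _; case/andP: h0r => /eqP <-.
  case/orP=> /eqP E0; last by move: y0; rewrite E0 /=; lia.
  case/orP=> /eqP Ef; first by move: yf; rewrite Ef /=; lia.
  have E0' : e0.2 = (z, y).
    have /vconn_s/andP[/eqP + _] : e0 \in e0 :: f :: r2 by rewrite mem_head.
    by rewrite E0 -y0 /= => ->; rewrite -surjective_pairing.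
  have Ef' : f.1 = (z', y).
    have /vconn_s/andP[/eqP + _] :
      f \in e0 :: f :: r2 by rewrite !inE eqxx orbT.
    by rewrite Ef -yf /= => <-; rewrite -surjective_pairing.
  have htop : hconn Q (i, j + 1) (k, j + 1).
    rewrite /hconn eqxx; apply/asboolP => /= t ht; rewrite addrK orbC inQ //=;
      lia.
  have hef : hconn Q f.2 e0.1.
    by rewrite E0 Ef; case: hz => -[-> ->] //; rewrite hconnC.
  (* If these two segments are the whole walk, the rectangle rule applies directly. Otherwise they
     form one closed walk, the other segments form a second one, and both are shorter. *)
  case: r2 Er => [|g2 r2] Er in ws IH vconn_s *.
    rewrite /balanced !big_cons !big_nil !mulr1 E0 E0' Ef Ef'.
    have inner c : i <= c.1 < k -> y <= c.2 < j + 1 -> c \in Q.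
      by move=> h1 h2; apply: inQ => //; lia.
    have lt_yj : y < j + 1 by lia.
    have := rect lt_ik lt_yj inner.
    by case: hz => -[-> ->]; [move=> -> | rewrite mulrC => ->; rewrite mulrC].
  have wf : closed_walk Q [:: e0; f].
    by rewrite /closed_walk /= !vconn_s ?inE ?eqxx ?orbT //= h0r hef.
  have wg : closed_walk Q (g2 :: r2).
    move: ws; rewrite /closed_walk /= => /andP[/and4P[_ _ -> ->]] /=.
    case/and3P=> _ hfg; rewrite !rcons_path => /andP[-> hl] /=.
    by apply: hconn_trans hl _; apply: hconn_trans hfg; rewrite hconnC.
  have := IH _ _ wf; have := IH _ _ wg; rewrite /balanced !big_cons !big_nil.
  rewrite /= !ltnS leqnSn => /(_ isT) -> /(_ isT).
  by rewrite !mulr1 => E; rewrite !mulrA E.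
have hi : i <= i <= k by lia.
have hk : i <= k <= k by lia.
have vi := corner i ei hi sei Ei; have vk := corner k ek hk sek Ek.
have ne_ei_ek : ei != ek.
  apply/eqP => E; move: vi vk; rewrite E.
  move=> /andP[/eqP /= e1 _] /andP[/eqP /= e2 _].
  by move: lt_ik; rewrite -e1 -e2 ltxx.
have [//|Hi] := cornerP i ei hi sei Ei.
have [//|Hk] := cornerP k ek hk sek Ek.
case: Hi Hk => [E|[r2 E]] [E'|[r2' E']].
- by rewrite E E' eqxx in ne_ei_ek.
- by apply: (main i k ek r2'); rewrite -?E //; left.
- by apply: (main k i ei r2); rewrite -?E' //; right.
- by move: ne_ei_ek; rewrite E in E'; case: E' => ->; rewrite eqxx.
Qed.

End WalkRule.
End AcyclicCollections.

(** * Acyclicity of simple collections and under gluing of a cell *)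

Section SimpleCollections.

Lemma in_cell_vertices (c v : point) :
  (v \in cell_vertices c) =
  (c.1 <= v.1 <= c.1 + 1) && (c.2 <= v.2 <= c.2 + 1).
Proof.
case: c v => c1 c2 [v1 v2]; rewrite !inE /= !xpair_eqE /=.
by apply/idP/idP; lia.
Qed.

Lemma share_edge_adj c d : share_edge c d -> cell_adj c d.
Proof.
case: c d => c1 c2 [d1 d2] /andP[+ _].
(* The common edge leaves two candidates for [d], one of which is [c]; the vertex [t] of [c] off
   this edge excludes [c]. *)
have edge (u v t : point) : t \in cell_vertices (c1, c2) -> t != u -> t != v ->
    cell_vertices (c1, c2) `&` cell_vertices (d1, d2) = [fset u; v] ->
    [/\ u \in cell_vertices (d1, d2), v \in cell_vertices (d1, d2)
      & t \notin cell_vertices (d1, d2)].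
  move=> ct tu tv /fsetP E; have := E t; have := E u; have := E v.
  rewrite !in_fsetI !in_fset2 ct !eqxx (negbTE tu) (negbTE tv) orbT /=.
  by move=> /andP[_ ->] /andP[_ ->] ->.
rewrite /cell_edges /itv_edges !inE /cell_adj /cell_ur /= -!orbA.
case/or4P=> /eqP E.
- have [|||] := edge _ _ (c1, c2 + 1) _ _ _ E;
  rewrite ?in_cell_vertices ?xpair_eqE /=; lia.
- have [|||] := edge _ _ (c1, c2) _ _ _ E;
  rewrite ?in_cell_vertices ?xpair_eqE /=; lia.
- have [|||] := edge _ _ (c1 + 1, c2) _ _ _ E;
  rewrite ?in_cell_vertices ?xpair_eqE /=; lia.
- have [|||] := edge _ _ (c1, c2) _ _ _ E;
  rewrite ?in_cell_vertices ?xpair_eqE /=; lia.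
Qed.

Lemma fset_bounded (Q : {fset point}) :
  exists N : int, forall c, c \in Q -> (`|c.1| < N) && (`|c.2| < N).
Proof.
suff [N HN] : exists N : int, forall c, c \in (Q : seq point) ->
    (`|c.1| < N) && (`|c.2| < N) by exists N.
elim: (Q : seq point) => [|[a b] s [N HN]]; first by exists 0.
exists (`|N| + `|a| + `|b| + 1) => -[c1 c2].
by rewrite inE => /predU1P[[-> ->]|/HN] /=; lia.
Qed.

(** A path outside [Q] leads to a cell so far away that [w] vanishes there, and [w] is constant
    along the path. *)
Lemma simple_acyclic Q : is_simple Q -> acyclic Q.
Proof.
move=> sQ w [N wN] wadj c cQ; have [M QM] := fset_bounded Q.
pose d : cell := (`|N| + `|M|, 0).
have dQ : d \notin Q by apply: contraTN isT => /QM; rewrite /d /=; lia.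
have wd : w d = 0 by apply/eqP; apply: contraTT isT => /wN; rewrite /d /=; lia.
have [s [_ ps ls sub]] := sQ c d cQ dQ; rewrite -wd -ls.
elim: s c cQ ps {ls} sub => //= e s IHs c cQ /andP[ce ps] sub.
have eQ : e \notin Q by apply: sub; rewrite !inE eqxx orbT.
rewrite (wadj c e) ?share_edge_adj //; apply: IHs => // z zs.
by apply: sub; rewrite inE zs orbT.
Qed.

Lemma acyclic0 : acyclic fset0.
Proof.
move=> w [N wN] wadj [a b] _.
have wr n : w (a, b) = w (a + n%:Z, b).
  elim: n => [|n ->]; first by rewrite addr0.
  by apply: wadj; rewrite ?inE // /cell_adj /=; lia.
rewrite (wr `|N - a|%N); apply/eqP; apply: contraTT isT => /wN /=; lia.
Qed.

(* The cell [A] is glued to [Q] at most along the edge towards [B]: all the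
   cells of [Q] around [A] lie on the side of [B]. *)
Lemma acyclic_add (Q : {fset cell}) (A B : cell) :
  cell_adj B A ->
  (forall X, X \in Q -> `|X.1 - A.1| <= 1 -> `|X.2 - A.2| <= 1 ->
     (X.1 - A.1) * (A.1 - B.1) + (X.2 - A.2) * (A.2 - B.2) < 0) ->
  (B \in Q) \/ Q = fset0 ->
  acyclic Q -> acyclic (A |` Q).
Proof.
case: A B => a1 a2 [b1 b2] /eqP /= BA free BQ aQ w [N wN] wadj c.
rewrite in_fset1U negb_or => /andP[cA cQ].
(* The unit vector [(e1, e2)] points from [B] to [A]; [(- e2, e1)] and [(e2, - e1)] are its two
   normals. *)
pose e1 := a1 - b1; pose e2 := a2 - b2.
have Q0 X : X \in Q -> Q = fset0 -> False by move=> + E; rewrite E.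
have out (x1 x2 : int) : `|x1| <= 1 -> `|x2| <= 1 -> 0 <= x1 * e1 + x2 * e2 ->
    (x1 != 0) || (x2 != 0) -> (a1 + x1, a2 + x2) \notin (a1, a2) |` Q.
  move=> h1 h2 h3 h4; rewrite in_fset1U negb_or xpair_eqE; apply/andP; split.
    by lia.
  apply: contraTN h3 => /free /=; rewrite /e1 /e2 -ltNge.
  have -> : a1 + x1 - a1 = x1 by lia.
  have -> : a2 + x2 - a2 = x2 by lia.
  exact.
have hE : [\/ e1 = 1 /\ e2 = 0, e1 = -1 /\ e2 = 0, e1 = 0 /\ e2 = 1
           | e1 = 0 /\ e2 = -1].
  have := @cell_adjP b1 b2 a1 a2; rewrite /cell_adj /= BA eqxx => /(_ isT).
  rewrite /e1 /e2 => -[] [? ?].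
  - by apply: Or41; split; lia.
  - by apply: Or42; split; lia.
  - by apply: Or43; split; lia.
  - by apply: Or44; split; lia.
have [Eb1 Eb2] : b1 = a1 - e1 /\ b2 = a2 - e2 by split; rewrite /e1 /e2; lia.
clearbody e1 e2; rewrite {}Eb1 {}Eb2 {BA free} in BQ *.
(* The five cells beside and in front of [A] avoid [A] and [Q] and form a path, so [w] takes the
   value [u] on all of them. *)
pose u := w (a1 + e1, a2 + e2).
have ring (x1 x2 y1 y2 : int) : `|x1 - y1| + `|x2 - y2| = 1 ->
    (a1 + x1, a2 + x2) \notin (a1, a2) |` Q ->
    (a1 + y1, a2 + y2) \notin (a1, a2) |` Q ->
    w (a1 + x1, a2 + x2) = w (a1 + y1, a2 + y2).
  by move=> h hx hy; apply: wadj => //; rewrite /cell_adj /=; apply/eqP; lia.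
have oe : (a1 + e1, a2 + e2) \notin (a1, a2) |` Q.
  by apply: out; clear -hE; case: hE => -[? ?]; subst; lia.
have ofe : (a1 + (e1 - e2), a2 + (e2 + e1)) \notin (a1, a2) |` Q.
  by apply: out; clear -hE; case: hE => -[? ?]; subst; lia.
have o_f : (a1 - e2, a2 + e1) \notin (a1, a2) |` Q.
  by apply: out; clear -hE; case: hE => -[? ?]; subst; lia.
have oge : (a1 + (e1 + e2), a2 + (e2 - e1)) \notin (a1, a2) |` Q.
  by apply: out; clear -hE; case: hE => -[? ?]; subst; lia.
have og : (a1 + e2, a2 - e1) \notin (a1, a2) |` Q.
  by apply: out; clear -hE; case: hE => -[? ?]; subst; lia.
have wf : w (a1 - e2, a2 + e1) = u.
  rewrite (ring (- e2) _ (e1 - e2) (e2 + e1)) ?(ring (e1 - e2) _ e1 e2) //.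
    by clear -hE; case: hE => -[? ?]; subst; lia.
  by clear -hE; case: hE => -[? ?]; subst; lia.
have wg : w (a1 + e2, a2 - e1) = u.
  rewrite (ring _ (- e1) (e1 + e2) (e2 - e1)) ?(ring (e1 + e2) _ e1 e2) //.
    by clear -hE; case: hE => -[? ?]; subst; lia.
  by clear -hE; case: hE => -[? ?]; subst; lia.
have near d : cell_adj (a1, a2) d -> d \notin Q -> w d = u.
  case: d => d1 d2 /cell_adjP adj_d dQ.
  have [[? ?]|[[? ?]|[[? ?]|[E1 E2]]]] : (d1 = a1 + e1 /\ d2 = a2 + e2) \/
      (d1 = a1 - e2 /\ d2 = a2 + e1) \/ (d1 = a1 + e2 /\ d2 = a2 - e1) \/
      (d1 = a1 - e1 /\ d2 = a2 - e2).
    clear -hE adj_d; case: hE adj_d => -[-> ->] [] [-> ->]; lia.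
  - by subst.
  - by subst.
  - by subst.
  (* The remaining neighbour is [B]. If it lies outside [Q], then [Q] is empty and a path around [A]
     reaches it. *)
  rewrite E1 E2 in dQ *.
  case: BQ => [BQ|Q0']; first by rewrite BQ in dQ.
  have oB (x1 x2 : int) : (x1 != 0) || (x2 != 0) ->
      (a1 + x1, a2 + x2) \notin (a1, a2) |` Q.
    by move=> ne; rewrite Q0' in_fset1U in_fset0 orbF xpair_eqE; lia.
  rewrite (ring (- e1) (- e2) (- e1 - e2) (- e2 + e1)); first last.
  - by apply: oB; clear -hE; case: hE => -[? ?]; subst; lia.
  - by apply: oB; clear -hE; case: hE => -[? ?]; subst; lia.
  - by clear -hE; case: hE => -[? ?]; subst; lia.
  rewrite (ring _ _ (- e2) e1) //.
  - by clear -hE; case: hE => -[? ?]; subst; lia.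
  - by apply: oB; clear -hE; case: hE => -[? ?]; subst; lia.
(* Filling [A] with the value [u] yields a function to which the acyclicity of [Q] applies. *)
pose w' X := if X == (a1, a2) then u else w X.
have w'adj x y : cell_adj x y -> x \notin Q -> y \notin Q -> w' x = w' y.
  rewrite /w' => xy xQ yQ.
  have [Ex|nx] := eqVneq x (a1, a2); have [Ey|ny] := eqVneq y (a1, a2) => //.
  - by rewrite near // -Ex.
  - by apply: near => //; rewrite -Ey /cell_adj distrC (distrC y.2).
  - by apply: wadj => //; rewrite in_fset1U negb_or ?nx ?ny.
have := aQ w' _ w'adj c cQ; rewrite /w' (negbTE cA); apply.
exists (`|N| + 1) => -[x1 x2];
  have [[-> ->] /wN|_ /wN] /= := (x1, x2) =P (a1, a2); last first.
  by clear; lia.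
by clear -hE; case: hE => -[-> ->]; lia.
Qed.

End SimpleCollections.

(** * Closed paths with one cell removed *)

Section ClosedPaths.

Lemma disjoint_cells (c d : cell) :
  cell_vertices c `&` cell_vertices d = fset0 ->
  ~~ ((`|c.1 - d.1| <= 1) && (`|c.2 - d.2| <= 1)).
Proof.
case: c d => c1 c2 [d1 d2] E /=; apply/negP => h.
(* For cells this close, the larger coordinates of the two lower left corners give a common
   vertex. *)
pose v : point := (Num.max c1 d1, Num.max c2 d2).
have /fsetP/(_ v) := E; rewrite in_fsetI !in_cell_vertices in_fset0 /v /=.
by move/negP; apply; clear -h; lia.
Qed.

Lemma two_steps_near (a b c : cell) : cell_adj a b -> cell_adj b c -> a != c ->
  (a.1 - c.1) * (c.1 - b.1) + (a.2 - c.2) * (c.2 - b.2) < 0.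
Proof.
case: a b c => a1 a2 [b1 b2] [c1 c2] /cell_adjP ab /cell_adjP bc.
rewrite xpair_eqE /= => ne.
by case: ab ne => -[? ?]; case: bc => -[? ?]; subst; lia.
Qed.

(** Every step turns, and two turns in the same sense would bring [d] next to [a]; so the turns
    alternate and the third step repeats the first. *)
Lemma zigzag (a b c d : cell) :
  cell_adj a b -> cell_adj b c -> cell_adj c d -> a != c -> b != d ->
  ~~ ((`|a.1 - d.1| <= 1) && (`|a.2 - d.2| <= 1)) ->
  ~~ ((c.1 - b.1 == b.1 - a.1) && (c.2 - b.2 == b.2 - a.2)) ->
  ~~ ((d.1 - c.1 == c.1 - b.1) && (d.2 - c.2 == c.2 - b.2)) ->
  (d.1 - b.1 = c.1 - a.1) /\ (d.2 - b.2 = c.2 - a.2).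
Proof.
case: a b c d => a1 a2 [b1 b2] [c1 c2] [d1 d2].
move=> /cell_adjP ab /cell_adjP bc /cell_adjP cd.
rewrite !xpair_eqE /= => h1 h2 h3 h4 h5.
case: ab => -[e1 e2]; subst; case: bc => -[e1 e2];
  try (exfalso; clear -e1 e2 h1 h4; lia);
  case: cd => -[e3 e4]; try (exfalso; clear -e1 e2 e3 e4 h2 h5; lia);
  clear -e1 e2 e3 e4 h3; split; lia.
Qed.

Variables (n : nat) (A : 'I_n -> cell).
Hypotheses (n_gt5 : (5 < n)%N) (injA : injective A).
Hypothesis shareA : forall i, share_edge (A i) (A (ordS i)).
Hypothesis disjA : forall i j,
  j \notin [:: ord_pred (ord_pred i); ord_pred i; i; ordS i; ordS (ordS i)] ->
  cell_vertices (A i) `&` cell_vertices (A j) = fset0.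

Let n_gt0 : (0 < n)%N. Proof. exact: leq_ltn_trans n_gt5. Qed.
Let idx (k : nat) : 'I_n := Ordinal (ltn_pmod k n_gt0).
Let b (k : nat) : cell := A (idx k).

Let ordS_idx k : ordS (idx k) = idx k.+1.
Proof. by apply/val_inj; rewrite /= -addn1 modnDml addn1. Qed.

Let idx_inj j k : (j < k < j + n)%N -> (idx j == idx k) = false.
Proof.
case/andP=> lt_jk lt_kn; apply/negbTE/eqP => /(congr1 val) /= /eqP.
rewrite eq_sym eqn_mod_dvd 1?ltnW // => /dvdn_leq;
  rewrite subn_gt0 => /(_ lt_jk).
by rewrite leqNgt ltn_subLR ?lt_kn // ltnW.
Qed.

Let b_adj k : cell_adj (b k) (b k.+1).
Proof. by rewrite /b -ordS_idx share_edge_adj. Qed.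

Let b_inj j k : (j < k < j + n)%N -> b j != b k.
Proof. by move=> h; rewrite (inj_eq injA) idx_inj. Qed.

Let b_far j k : (j + 3 <= k)%N -> (k + 3 <= j + n)%N ->
  ~~ ((`|(b j).1 - (b k).1| <= 1) && (`|(b j).2 - (b k).2| <= 1)).
Proof.
move=> h1 h2; apply/disjoint_cells/disjA; rewrite !inE !negb_or.
rewrite !ordS_idx -!(can2_eq (@ordSK n) (@ord_predK n)) !ordS_idx.
rewrite ![idx k.+2 == _]eq_sym ![idx k.+1 == _]eq_sym ![idx k == _]eq_sym.
by rewrite !idx_inj //; lia.
Qed.

(** Without three cells in a row the path would be a staircase by [zigzag], with a constant nonzero
    displacement over two steps, and could not close up. *)
Let b_straight : exists k, ((b k.+2).1 - (b k.+1).1 = (b k.+1).1 - (b k).1) /\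
                           ((b k.+2).2 - (b k.+1).2 = (b k.+1).2 - (b k).2).
Proof.
apply: contrapT => nostr.
have ns k : ~~ (((b k.+2).1 - (b k.+1).1 == (b k.+1).1 - (b k).1) &&
                ((b k.+2).2 - (b k.+1).2 == (b k.+1).2 - (b k).2)).
  by apply/negP => /andP[/eqP h1 /eqP h2]; apply: nostr; exists k.
have zz k := zigzag (b_adj k) (b_adj k.+1) (b_adj k.+2).
have step k : ((b k.+2).1 - (b k).1 = (b 2).1 - (b 0).1) /\
              ((b k.+2).2 - (b k).2 = (b 2).2 - (b 0).2).
  elim: k => // k [<- <-]; apply: zz; rewrite ?b_inj ?b_far ?ns //; lia.
have walk m : ((b m.*2).1 = (b 0).1 + m%:Z * ((b 2).1 - (b 0).1)) /\
              ((b m.*2).2 = (b 0).2 + m%:Z * ((b 2).2 - (b 0).2)).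
  elim: m => [|m [E1 E2]]; first by rewrite !mul0r !addr0.
  have [F1 F2] := step m.*2; rewrite doubleS; split.
    by rewrite -(subrK (b m.*2).1 (b m.*2.+2).1) F1 E1; clear; lia.
  by rewrite -(subrK (b m.*2).2 (b m.*2.+2).2) F2 E2; clear; lia.
(* After [2 * n] steps the path is back at [b 0], so the displacement is zero. *)
have := walk n; rewrite (_ : b n.*2 = b 0); last first.
  by congr (A _); apply/val_inj; rewrite /= -mul2n modnMl mod0n.
have aux (x y z : int) : x = x + n%:Z * (y - z) -> y = z.
  move/eqP; rewrite -{1}[x]addr0 (inj_eq (addrI x)) eq_sym mulf_eq0 subr_eq0.
  by case/orP=> /eqP //; clear -n_gt5; lia.
case=> /aux h1 /aux h2; have h02 : (0 < 2 < 0 + n)%N by clear -n_gt5; lia.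
by have := b_inj h02;
  rewrite (surjective_pairing (b 2)) h1 h2 -surjective_pairing eqxx.
Qed.

(** The middle of three cells in a row is removed, and the remaining arc is built cell by cell with
    [acyclic_add]. *)
Lemma closed_path_remove :
  exists i, acyclic ([fset A i | i : 'I_n] `\ A i).
Proof.
have [k0 [str1 str2]] := b_straight.
(* The removed cell is [c 0]; the arc consists of [c 1] up to [c n.-1]. *)
pose c i := b (k0 + i.+1).
pose arc := fix arc k := if k is k'.+1 then c k |` arc k' else fset0.
have arcP k X : reflect (exists2 i, (0 < i <= k)%N & X = c i) (X \in arc k).
  elim: k X => [|k IHk] X; first by rewrite inE; constructor => -[i]; lia.
  rewrite in_fset1U; apply: (iffP idP).
    case/predU1P=> [->|/IHk[i hi ->]]; first by exists k.+1; rewrite //= leqnn.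
    by exists i => //; lia.
  case=> i hi ->; case: (eqVneq i k.+1) => [->|ne]; first by rewrite eqxx.
  by apply/orP; right; apply/IHk; exists i => //; lia.
have acyc k : (k < n)%N -> acyclic (arc k).
  elim: k => [|k IHk] lt_kn; first exact: acyclic0.
  have c_adj i : cell_adj (c i) (c i.+1) by rewrite /c !addnS.
  apply: (acyclic_add (B := c k)) (IHk (ltnW lt_kn)); first exact: c_adj.
    move=> X /arcP[i hi ->] n1 n2.
    have [Ei|ne_ik] := eqVneq i k.
      have := c_adj k; rewrite Ei; case: (c k) (c k.+1) => [x1 x2] [y1 y2].
      by move=> /cell_adjP[] [? ?]; subst => /=; clear; lia.
    have [Ei|ne_ik1] := eqVneq i.+1 k.
      rewrite -Ei; apply: two_steps_near; rewrite ?c_adj //.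
      by apply: b_inj; lia.
    have [far|close] := leqP (k.+1 + 3) (i + n).
      have /negP[] : ~~ ((`|(c i).1 - (c k.+1).1| <= 1) &&
                         (`|(c i).2 - (c k.+1).2| <= 1)) by apply: b_far; lia.
      by rewrite n1 n2.
    (* Only the two ends of the arc are left. They are the outer cells of the three in a row, hence
       two units apart. *)
    have [Ei Ek] : i = 1%N /\ k.+1 = n.-1 by lia.
    have En : c n.-1 = b k0.
      congr (A _); apply/val_inj; rewrite /= (_ : k0 + _ = k0 + n)%N ?modnDr //.
      by lia.
    exfalso; move: n1 n2 (b_adj k0); rewrite Ek Ei En /c !addnS addn0.
    move: str1 str2; case: (b k0) (b k0.+1) (b k0.+2) =>
      [x1 x2] [y1 y2] [z1 z2].
    by move=> /= h1 h2 h3 h4 /cell_adjP; clear -h1 h2 h3 h4; case=> -[? ?];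
      subst; lia.
  by case: k {IHk lt_kn} => [|k]; [right | left; rewrite /= in_fset1U eqxx].
exists (idx (k0 + 1)); rewrite (_ : _ `\ _ = arc n.-1);
  first by apply: acyc; lia.
apply/fsetP => X; rewrite in_fsetD1; apply/andP/arcP.
  case=> neX /imfsetP[j /= _ EX].
  (* The multiple of [n] keeps the subtraction from being truncated at zero. *)
  pose i := ((j + n * (k0 + 1) - (k0 + 1)) %% n)%N.
  have Ei : A j = c i.
    congr (A _); apply/val_inj;
      rewrite /= /i addnS -addSn -[k0.+1]addn1 modnDmr subnKC.
      by rewrite [(j + _)%N]addnC mulnC modnMDl modn_small.
    by rewrite -[X in (X <= _)%N]mul1n; nia.
  exists i; last by rewrite EX.
  have lt_in : (i < n)%N by rewrite /i ltn_mod.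
  apply/andP; split; last by lia.
  rewrite lt0n; apply: contraNneq neX => i0.
  by rewrite EX Ei i0 /c /b.
case=> i hi ->; split; last by apply/imfsetP; exists (idx (k0 + i.+1)).
by rewrite eq_sym; apply: b_inj; lia.
Qed.

End ClosedPaths.

Lemma closed_path_acyclic P :
  is_closed_path P -> exists2 A, A \in P & acyclic (P `\ A).
Proof.
case=> _ [n [A [n_gt5 injA -> shareA disjA]]].
have [i ai] := closed_path_remove n_gt5 injA shareA disjA.
by exists (A i) => //; apply/imfsetP; exists i.
Qed.

(** * Corner sums of weights on cells and alternating walks *)

Section Boundary.

Variable F : realFieldType.
Implicit Types (w : cell -> F) (Q : {fset cell}).

(* The signed corner sum: [corner_sum w] is the exponent vector of the product
   over the cells [c] of the [w c]-th powers of the 2-minors of [c]. *)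
Definition corner_sum w (v : point) : F :=
  w (v.1 - 1, v.2 - 1) + w v - w (v.1 - 1, v.2) - w (v.1, v.2 - 1).

(** At a drop, a negative run starts upwards or a positive run starts downwards. It ends because [g]
    vanishes far away, and its end is a rise. *)
Lemma sign_change (g : int -> F) (N y0 : int) :
  (forall t, N <= `|t| -> g t = 0) -> g y0 < g (y0 - 1) ->
  exists2 y1, g (y1 - 1) < g y1 & all_between (fun t => g t != 0) y0 y1.
Proof.
move=> g0 gy; have [gneg|gpos] := ltP (g y0) 0.
  have [||y1 [lt01 gy1] miny] := @int_min (fun t => y0 < t /\ 0 <= g t) y0
      (`|N| + `|y0| + 1).
  - by split; [lia | rewrite g0 //; lia].
  - by move=> t [/ltW].
  have neg t : y0 <= t < y1 -> g t < 0.
    case: (eqVneq t y0) => [->//|ne] ht; rewrite ltNge; apply/negP => ge0.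
    have lt0 : y0 < t by lia.
    by have := miny t (conj lt0 ge0); lia.
  exists y1; first by apply: lt_le_trans (neg _ _) gy1; lia.
  by apply/asboolP => t ht; rewrite lt_eqF // neg //; lia.
have gy' : 0 < g (y0 - 1) := le_lt_trans gpos gy.
have [||y1 [lt10 gy1] maxy] := @int_max (fun t => t < y0 /\ g (t - 1) <= 0) y0
      (- (`|N| + `|y0| + 1)).
- by split; [lia | rewrite g0 //; lia].
- by move=> t [/ltW].
have pos t : y1 <= t < y0 -> 0 < g t.
  case: (eqVneq t (y0 - 1)) => [->//|ne] ht; rewrite ltNge; apply/negP => le0.
  have lt0 : t + 1 < y0 by lia.
  by have := maxy (t + 1); rewrite addrK => /(_ (conj lt0 le0)); lia.
exists y1; first by apply: le_lt_trans gy1 (pos _ _); lia.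
by apply/asboolP => t ht; rewrite gt_eqF // pos //; lia.
Qed.

Variables (Q : {fset cell}) (w : cell -> F).
Hypothesis wQ : forall c, c \notin Q -> w c = 0.

Let supp c : w c != 0 -> c \in Q.
Proof. by move=> n0; apply: contraNT n0 => /wQ ->. Qed.

Lemma corner_sum_vertices v : corner_sum w v != 0 -> v \in vertices Q.
Proof.
move=> n0; have [c cQ vc] : exists2 c, c \in Q & v \in cell_vertices c.
  case: v n0 => a b; rewrite /corner_sum /= => n0; apply: contrapT => nex.
  have out c : (a, b) \in cell_vertices c -> w c = 0.
    move=> vc; apply/eqP; apply: contrapT => /negP/supp cQ.
    by apply: nex; exists c.
  by case/negP: n0; rewrite !out ?in_cell_vertices /= ?subr0 ?addr0 //; lia.
by apply/bigfcupP; exists c => //; rewrite cQ.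
Qed.

(** Along a column the corner sum is a difference of consecutive values of [g], and where [g] is
    nonzero the edge bounds a cell of [Q]. *)
Lemma corner_sum_vconn p :
  0 < corner_sum w p -> exists2 q, corner_sum w q < 0 & vconn Q p q.
Proof.
case: p => a b; have [N QN] := fset_bounded Q.
pose g y := w (a - 1, y) - w (a, y).
have gE y : corner_sum w (a, y) = g (y - 1) - g y.
  by rewrite /corner_sum /g /=; ring.
rewrite gE subr_gt0 => /(sign_change (N := N)) [t ht|y1 gy1 /asboolP nz].
  by rewrite /g !wQ ?subrr //; apply/negP => /QN /=; clear -ht; lia.
exists (a, y1); first by rewrite gE subr_lt0.
rewrite /vconn eqxx; apply/asboolP => /= t /nz; rewrite /g.
by case: (eqVneq (w (a - 1, t)) 0) => [->|/supp ->];
  rewrite ?orbT // sub0r oppr_eq0 => /supp ->.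
Qed.

Lemma corner_sum_hconn q :
  corner_sum w q < 0 -> exists2 p, 0 < corner_sum w p & hconn Q q p.
Proof.
case: q => a b; have [N QN] := fset_bounded Q.
pose g x := w (x, b) - w (x, b - 1).
have gE x : corner_sum w (x, b) = g x - g (x - 1).
  by rewrite /corner_sum /g /=; ring.
rewrite gE subr_lt0 => /(sign_change (N := N)) [t ht|x1 gx1 /asboolP nz].
  by rewrite /g !wQ ?subrr //; apply/negP => /QN /=; clear -ht; lia.
exists (x1, b); first by rewrite gE subr_gt0.
rewrite /hconn eqxx; apply/asboolP => /= t /nz; rewrite /g.
by case: (eqVneq (w (t, b)) 0) => [->|/supp ->] //;
  rewrite sub0r oppr_eq0 => /supp ->; rewrite orbT.
Qed.

(** The upper right corner of a cell of the support with largest coordinate sum receives a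
    contribution from this cell alone. *)
Lemma corner_sum_neq0 c : w c != 0 -> exists v, corner_sum w v != 0.
Proof.
have [N QN] := fset_bounded Q; move=> nwc.
have [||m [[a b] nw <-] maxm] :=
  @int_max (fun t => exists2 c, w c != 0 & c.1 + c.2 = t) (N + N) (c.1 + c.2).
- by exists c.
- by move=> t [d /supp/QN + <-]; case: d => d1 d2 /=; clear; lia.
have out d : (a, b).1 + (a, b).2 < d.1 + d.2 -> w d = 0.
  move=> lt_abd; apply/eqP; apply: contraTT lt_abd => nwd.
  by rewrite -leNgt; apply: maxm; exists d.
exists (a + 1, b + 1); rewrite /corner_sum /= !addrK.
by rewrite !(out (_ + 1, _)) ?(out (_, _ + 1)) ?subr0 ?addr0 //=; clear; lia.
Qed.

(** From a positive vertex a vertical segment leads to a negative one, and from there a horizontal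
    segment to a positive one. As there are finitely many vertices, the iteration repeats and closes
    a walk. *)
Lemma alternating_walk c : w c != 0 ->
  exists s, [/\ s != [::], closed_walk Q s &
    forall e, e \in s -> 0 < corner_sum w e.1 /\ corner_sum w e.2 < 0].
Proof.
case/corner_sum_neq0=> v nv.
have [p0 pos0] : exists p, 0 < corner_sum w p.
  move: nv; rewrite neq_lt => /orP[/corner_sum_hconn[p hp _]|];
    last by exists v.
  by exists p.
have /choice[nxt nxtP] : forall p, exists e : point * point,
    0 < corner_sum w p -> [/\ corner_sum w e.1 < 0, 0 < corner_sum w e.2,
      vconn Q p e.1 & hconn Q e.1 e.2].
  move=> p; have [hp|_] := ltP 0 (corner_sum w p); last by exists (p, p).
  have [q hq pq] := corner_sum_vconn hp;
    have [p' hp' qp'] := corner_sum_hconn hq.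
  by exists (q, p').
pose P k := iter k (fun p => (nxt p).2) p0.
have posP k : 0 < corner_sum w (P k).
  by elim: k => //= k /nxtP[].
pose f k := (P k, (nxt (P k)).1).
have fR k : hconn Q (f k).2 (f k.+1).1 by have [] := nxtP _ (posP k).
have : ~~ uniq [seq P k | k <- iota 0 (size (vertices Q)).+1].
  have sub : {subset [seq P k | k <- iota 0 (size (vertices Q)).+1]
                <= (vertices Q : seq point)}.
    move=> _ /mapP[k _ ->]; apply: corner_sum_vertices.
    by rewrite gt_eqF.
  apply/negP => U; have := uniq_leq_size U sub.
  by rewrite size_map size_iota ltnn.
case/(uniqPn p0) => i [j [lt_ij]]; rewrite size_map size_iota => lt_j.
rewrite !(nth_map 0%N) ?size_iota ?(ltn_trans lt_ij) //
  !nth_iota ?(ltn_trans lt_ij) //.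
rewrite !add0n => Pij; have fij : f i = f j by rewrite /f Pij.
have [m Em] : exists m, (j - i = m.+1)%N.
  by exists (j - i).-1; rewrite prednK // subn_gt0.
exists [seq f k | k <- iota i m.+1]; split=> //.
- apply/andP; split.
    by apply/allP => _ /mapP[k _ ->]; have [] := nxtP _ (posP k).
  have -> : cycle (fun e e' : point * point => hconn Q e.2 e'.1)
      [seq f k | k <- iota i m.+1] =
    path (fun e e' => hconn Q e.2 e'.1) (f i) [seq f k | k <- iota i.+1 m.+1].
    have -> : iota i.+1 m.+1 = rcons (iota i.+1 m) j.
      rewrite -(addn1 m) iotaD /= cats1; congr rcons.
      by rewrite addSnnS -Em subnKC // ltnW.
    by rewrite map_rcons -fij.
  by elim: m.+1 i {lt_ij Pij fij Em} => //= k IHk i; rewrite fR IHk.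
- move=> _ /mapP[k _ ->] /=; split; first exact: posP.
  by have [] := nxtP _ (posP k).
Qed.

End Boundary.

Section CornerSumKernel.

(** There are more weights to choose than linear conditions, one for each vertex outside [U]. *)
Lemma corner_sum_kernel (F : realFieldType) (Q U : {fset point}) :
  (#|` vertices Q `\` U | < #|` Q|)%N ->
  exists w : cell -> F, [/\ forall c, c \notin Q -> w c = 0,
    exists c, w c != 0 & forall v, v \notin U -> corner_sum w v = 0].
Proof.
set W := _ `\` _ => lt_WQ.
pose ind (c d : cell) : F := (d == c)%:R.
pose M : 'M[F]_(#|{: Q}|, #|{: W}|) :=
  \matrix_(i, j) corner_sum (ind (val (enum_val i))) (val (enum_val j)).
have nfree : ~~ row_free M.
  rewrite /row_free neq_ltn (leq_ltn_trans (rank_leq_col M)) //.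
  by rewrite -!cardfE.
pose r := nz_row (kermx M).
have nr : r != 0 by rewrite nz_row_eq0 kermx_eq0.
have rM : r *m M = 0 by apply/sub_kermxP/nz_row_sub.
pose w c := \sum_i r 0 i * ind (val (enum_val i)) c.
have wE i : w (val (enum_val i)) = r 0 i.
  rewrite /w (bigD1 i) //= big1 ?addr0 => [|j ne]; rewrite /ind ?eqxx ?mulr1 //.
  by rewrite (inj_eq val_inj) (inj_eq enum_val_inj) eq_sym (negbTE ne) mulr0.
have wQ c : c \notin Q -> w c = 0.
  move=> cQ; rewrite /w big1 // => i _; rewrite /ind.
  by case: eqP => [E|_]; [rewrite E fsvalP in cQ | rewrite mulr0].
exists w; split=> //.
  have /rowP/existsNP[i /eqP] : r <> 0 by apply/eqP.
  by rewrite mxE -wE => ?; exists (val (enum_val i)).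
move=> v vU; apply/eqP; apply: contraTT isT => n0.
have vW : v \in W by rewrite in_fsetD vU (corner_sum_vertices wQ).
case/negP: n0; have /rowP/(_ (enum_rank [` vW])) := rM; rewrite !mxE => <-.
rewrite /corner_sum /w -!big_split -!sumrB /=; apply/eqP/eq_bigr => i _.
by rewrite mxE enum_rankK /= /corner_sum; ring.
Qed.

End CornerSumKernel.

(** * Prime ideals as kernels of maps to fields *)

Section PrimeQuotient.

Local Open Scope quotient_scope.

Variables (R : comNzRingType) (p : set R) (prime_p : is_prime_ideal p).

Definition prime_pred : {pred R} := mem p.

HB.instance Definition _ := isIdealr.Build R prime_pred prime_p.1.
HB.instance Definition _ := isPrimeIdealrClosed.Build R prime_pred prime_p.2.

Definition residue : Type := {ideal_quot prime_pred}.
HB.instance Definition _ := GRing.ComNzRing.on residue.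

Definition residue_unit : {pred residue} := fun x => `[< exists y, y * x = 1 >].
(** Inverses are chosen classically and non-units are fixed, to make the quotient an integral domain
    with a fraction field. *)
Definition residue_inv (x : residue) : residue :=
  if pselect (exists y, y * x = 1) is left ex then projT1 (cid ex) else x.

Lemma residue_mulVx : {in residue_unit, left_inverse 1 residue_inv *%R}.
Proof.
move=> x /asboolP ux; rewrite /residue_inv.
by case: pselect => // ex; case: cid.
Qed.

Lemma residue_unitPl (x y : residue) : y * x = 1 -> residue_unit x.
Proof. by move=> yx; apply/asboolP; exists y. Qed.

Lemma residue_invx_out : {in [predC residue_unit], residue_inv =1 id}.
Proof.
move=> x /asboolP ux; rewrite /residue_inv.
by case: pselect.
Qed.

HB.instance Definition _ := GRing.ComNzRing_hasMulInverse.Build residue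
  residue_mulVx residue_unitPl residue_invx_out.
HB.instance Definition _ := GRing.ComUnitRing_isIntegral.Build residue
  (@Quotient.rquot_IdomainAxiom R prime_pred).

Definition residue_pi (x : R) : residue := \pi_({ideal_quot prime_pred}) x.

Lemma residue_piB x y : residue_pi (x - y) = residue_pi x - residue_pi y.
Proof. exact: (rmorphB (\pi_({ideal_quot prime_pred}) :
  {rmorphism R -> _})). Qed.

Lemma residue_piM x y : residue_pi (x * y) = residue_pi x * residue_pi y.
Proof. exact: (rmorphM (\pi_({ideal_quot prime_pred}) :
  {rmorphism R -> _})). Qed.

Lemma residue_pi1 : residue_pi 1 = 1.
Proof. exact: (rmorph1 (\pi_({ideal_quot prime_pred}) :
  {rmorphism R -> _})). Qed.

Lemma residue_pi_eq0 x : (residue_pi x == 0) = (x \in prime_pred).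
Proof.
by rewrite -[x in RHS]subr0 Quotient.idealrBE
  (rmorph0 (\pi_({ideal_quot prime_pred}))).
Qed.

Definition residue_map (x : R) : {fraction residue} :=
  FracField.tofrac (residue_pi x).

Lemma residue_map_is_zmod_morphism : zmod_morphism residue_map.
Proof. by move=> x y; rewrite /residue_map residue_piB rmorphB. Qed.

Lemma residue_map_is_monoid_morphism : monoid_morphism residue_map.
Proof.
by split=> [|x y]; rewrite /residue_map ?residue_pi1 ?residue_piM ?rmorph1
  ?rmorphM.
Qed.

HB.instance Definition _ :=
  GRing.isZmodMorphism.Build R {fraction residue} residue_map
    residue_map_is_zmod_morphism.
HB.instance Definition _ :=
  GRing.isMonoidMorphism.Build R {fraction residue} residue_map
    residue_map_is_monoid_morphism.

Lemma residue_map_eq0 x : residue_map x = 0 <-> p x.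
Proof.
have E : (residue_map x == 0) = (x \in prime_pred).
  by rewrite /residue_map tofrac_eq0 residue_pi_eq0.
split=> [/eqP|px]; first by rewrite E => /asboolP.
by apply/eqP; rewrite E; apply/asboolP.
Qed.

End PrimeQuotient.

Lemma prime_ideal_kernel (R : comNzRingType) (p : set R) : is_prime_ideal p ->
  exists (E : fieldType) (f : {rmorphism R -> E}), forall x, f x = 0 <-> p x.
Proof.
by move=> hp; exists {fraction residue hp}, (residue_map hp);
  apply: residue_map_eq0.
Qed.

Lemma kernel_prime_ideal (R : comNzRingType) (D : idomainType)
    (f : {rmorphism R -> D}) :
  is_prime_ideal [set x | f x = 0]%classic.
Proof.
set p := [set x | _]%classic.
have memE x : (x \in mem p) = (f x == 0) by apply/asboolP/eqP.
split; first split; rewrite ?memE ?rmorph0 ?rmorph1 ?oner_eq0 //.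
  move=> a x y; rewrite !memE rmorphD rmorphM => /eqP-> /eqP->.
  by rewrite mulr0 addr0.
by move=> x y; rewrite !memE rmorphM mulf_eq0.
Qed.

(** * Polynomials in a subset of the variables *)

Section MultivariatePolynomials.

Variables (N : nat) (K : comNzRingType).
Implicit Types (F G : {mpoly K[N]}) (T : {set 'I_N}).

Definition poly_in T F : Prop :=
  forall m, m \in msupp F -> forall i, i \notin T -> m i = 0%N.

Lemma poly_inS T T' F : T \subset T' -> poly_in T F -> poly_in T' F.
Proof.
by move=> /fintype.subsetP sTT' inF m /inF H i iT'; apply: H;
  apply: contraNN iT' => /sTT'.
Qed.

Lemma mmap_eq_in (S : nzRingType) (f : K -> S) (h h' : 'I_N -> S) T F :
  poly_in T F -> {in T, h =1 h'} -> mmap f h F = mmap f h' F.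
Proof.
move=> inF eqh; rewrite /mmap !big_seq; apply: eq_bigr => m /inF m0.
congr (_ * _); apply: eq_bigr => i _.
by have [/eqh ->|/m0 ->] := boolP (i \in T); rewrite ?expr0.
Qed.

Lemma rmorph_mmap (S : comNzRingType) (f : {rmorphism {mpoly K[N]} -> S}) F :
  f F = mmap (f \o @mpolyC N K) (fun i => f 'X_i) F.
Proof.
rewrite {1}(mpolyE F) rmorph_sum; apply: eq_bigr => m _.
rewrite -mul_mpolyC rmorphM mpolyXE_id rmorph_prod /=; congr (_ * _).
by apply: eq_bigr => i _; rewrite rmorphXn.
Qed.

Variable j : 'I_N.

Definition mdrop (m : 'X_{1..N}) : 'X_{1..N} :=
  [multinom (if i == j then 0 else m i)%N | i < N].

(** The coefficient of the [k]-th power of ['X_j], kept in the same ring though free of ['X_j]. *)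
Definition coef_at (k : nat) F : {mpoly K[N]} :=
  \sum_(m <- msupp F | m j == k) F@_m *: 'X_[mdrop m].

Lemma mmap_coef_at (S : comNzRingType) (f : {rmorphism K -> S}) h F :
  mmap f h F = \sum_(k < msize F) mmap f h (coef_at k F) * h j ^+ k.
Proof.
have E k : mmap f h (coef_at k F) * h j ^+ k =
    \sum_(m <- msupp F) if k == m j then f F@_m * mmap1 h m else 0.
  rewrite raddf_sum mulr_suml -big_mkcond /=.
  rewrite (eq_bigl (fun m : 'X_{1..N} => k == m j)); last first.
    by move=> m; rewrite eq_sym.
  apply: eq_bigr => m /eqP ->; rewrite mmapZ mmapX -mulrA; congr (_ * _).
  rewrite /mmap1 (bigD1 j) //= mnmE eqxx expr0 mul1r [RHS](bigD1 j) //= mulrC.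
  by congr (_ * _); apply: eq_bigr => i /negbTE ne; rewrite mnmE ne.
under [RHS]eq_bigr => k _ do rewrite E.
rewrite exchange_big /= /mmap big_seq [RHS]big_seq.
apply: eq_bigr => m mF.
have lt_mj : (m j < msize F)%N.
  by apply: leq_ltn_trans (msize_mdeg_lt mF);
    rewrite mdegE (bigD1 j) //= leq_addr.
rewrite (bigD1 (Ordinal lt_mj)) //= eqxx big1 ?addr0 // => k ne.
by rewrite ifN //; apply: contraNN ne => /eqP E1; apply/eqP/val_inj.
Qed.

Lemma coef_at_in T k F : poly_in (j |: T) F -> poly_in T (coef_at k F).
Proof.
move=> inF m /msupp_sum_le /flattenP[s /mapP[m' +]] ->.
rewrite mem_filter => /andP[_ m'F] /msuppZ_le.
rewrite msuppX inE => /eqP -> i iT; rewrite mnmE; case: eqP => // /eqP ne.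
by apply: (inF _ m'F); rewrite in_setU1 negb_or ne.
Qed.

Lemma coef_at_eq0 F : (forall k, coef_at k F = 0) -> F = 0.
Proof.
move=> c0; have := rmorph_mmap (idfun : {rmorphism {mpoly K[N]} -> _}) F.
rewrite /= => ->.
by rewrite (mmap_coef_at (idfun \o @mpolyC N K)) big1 // => k _;
  rewrite c0 raddf0 mul0r.
Qed.

End MultivariatePolynomials.

Lemma sum_exp_split (R : comPzRingType) (k B : nat) (a : nat -> R) (x : R) :
  (forall i, (i < k)%N -> a i = 0) -> (k < B)%N ->
  exists H, \sum_(i < B) a i * x ^+ i = x ^+ k * (a k + x * H).
Proof.
elim: k B a => [|k IHk] [|B] a a0 // lt_kB; rewrite big_ord_recl.
  exists (\sum_(i < B) a i.+1 * x ^+ i); rewrite !expr0 mulr1 mul1r mulr_sumr.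
  by congr (_ + _); apply: eq_bigr => i _; rewrite !lift0 /= exprS; ring.
have [i lt_i|//|H EH] := IHk B (a \o S); first exact: a0.
exists H; rewrite a0 // mul0r add0r exprS -mulrA -EH mulr_sumr.
by apply: eq_bigr => i _; rewrite !lift0 /= exprS; ring.
Qed.

(** * Algebraic independence and the length of prime chains *)

Section AlgebraicIndependence.

Variables (n : nat) (K : fieldType).
Local Notation S := {mpoly K[n]}.

Definition alg_indep (p : set S) (N : nat) (g : 'I_N -> S) (T : {set 'I_N}) :=
  forall F : {mpoly K[N]},
    poly_in T F -> p (mmap (@mpolyC n K) g F) -> F = 0.

Lemma prime_mul (p : set S) : is_prime_ideal p ->
  forall x y, p (x * y) -> p x \/ p y.
Proof.
case=> _ hp x y pxy; have : x * y \in mem p by apply/asboolP.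
by case/hp/orP=> /asboolP; [left | right].
Qed.

Lemma ideal_sub (p : set S) : is_prime_ideal p ->
  forall a x y, p x -> p (y + x * a) -> p y.
Proof.
case=> -[_ _ hp] _ a x y px pyx; have := hp (- a) x (y + x * a).
have -> : - a * x + (y + x * a) = y by ring.
by move=> H; apply/asboolP; apply: H; apply/asboolP.
Qed.

Lemma ideal0 (p : set S) : is_prime_ideal p -> p 0.
Proof. by case=> -[/asboolP]. Qed.

(* A new element of [q] outside [p] satisfies no algebraic relation modulo [p]
   over elements which are independent modulo [q]: after division by a power
   of that element, the constant coefficient of the relation lies in [q]. *)
Lemma alg_indep_add (p q : set S) (N : nat) (g : 'I_N -> S)
    (T : {set 'I_N}) j f :
  is_prime_ideal p -> is_prime_ideal q -> (p `<=` q)%classic ->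
  q f -> ~ p f -> j \notin T -> alg_indep q g T ->
  alg_indep p (fun i => if i == j then f else g i) (j |: T).
Proof.
move=> hp hq spq qf npf jT ind F inF; set g' := fun i => _ => pF.
apply: contrapT => F0.
have exk : exists k, coef_at j k F != 0.
  apply: contrapT => nex; apply: F0; apply: (@coef_at_eq0 _ _ j) => k.
  by apply/eqP; apply: contrapT => /negP nk; apply: nex; exists k.
case: (ex_minnP exk) => k nk mink.
have lt_k : (k < msize F)%N.
  rewrite ltnNge; apply: contraNN nk => le_k.
  rewrite /coef_at big_seq_cond big1 // => m /andP[/msize_mdeg_lt lt_m /eqP Em].
  move: lt_m; rewrite ltnNge (leq_trans le_k) // -Em mdegE (bigD1 j) //=.
  exact: leq_addr.
have [|//|H EH] := @sum_exp_split _ k (msize F)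
  (fun i => mmap (@mpolyC n K) g' (coef_at j i F)) f.
  move=> i lt_ik; rewrite (_ : coef_at j i F = 0) ?raddf0 //.
  by apply/eqP; apply: contraTT lt_ik => /mink; rewrite leqNgt.
move: pF; rewrite (mmap_coef_at j) {2}/g' eqxx EH.
case/(prime_mul hp) => [pfk|pk].
  apply: npf; elim: (k) pfk => [|i IHi];
    last by rewrite exprS => /(prime_mul hp)[].
  by rewrite expr0; case: hp => -[_ /asboolP].
have inG := @coef_at_in _ _ j T k F inF.
case/negP: nk; apply/eqP; apply: ind => //.
rewrite -(@mmap_eq_in _ _ _ _ g' _ T) //; last first.
  by move=> i iT; rewrite /g' ifN //; apply: contraNneq jT => <-.
by apply: (ideal_sub hq qf (a := H)); apply: spq.
Qed.

(** There are more monomials with exponents below [D] in the variables of [T] than coefficients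
    available to their images, so the images are linearly dependent. *)
Lemma poly_many_dependent (N : nat) (g : 'I_N -> S) (T : {set 'I_N}) :
  (n < #|T|)%N ->
  exists F : {mpoly K[N]},
    [/\ F != 0, poly_in T F & mmap (@mpolyC n K) g F = 0].
Proof.
move=> lt_nT; pose e := (\sum_i msize (g i))%N.
(* [C] ensures that the images have exponents below [D * C], and [D] that [D ^ n.+1] exceeds
   [(D * C) ^ n]. *)
pose C := (N * e).+1; pose D := (C ^ n).+1.
pose rowT := {ffun {i | i \in T} -> 'I_D}.
pose colT := {ffun 'I_n -> 'I_(D * C)}.
pose mono (r : rowT) : 'X_{1..N} :=
  [multinom (if insub i is Some u then r u : nat else 0)%N | i < N].
pose comono (c : colT) : 'X_{1..n} := [multinom (c i : nat) | i < n].
pose M : 'M[K]_(#|{: rowT}|, #|{: colT}|) := \matrix_(i, j)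
  (mmap (@mpolyC n K) g 'X_[mono (enum_val i)])@_(comono (enum_val j)).
have lt_card : (#|{: colT}| < #|{: rowT}|)%N.
  rewrite !card_ffun !card_ord card_sig expnMn.
  apply: leq_trans (_ : D ^ n.+1 <= _)%N;
    last by rewrite leq_exp2l ?ltnS ?expn_gt0.
  by rewrite expnSr ltn_pmul2l ?expn_gt0.
have nfree : ~~ row_free M.
  by rewrite /row_free neq_ltn (leq_ltn_trans (rank_leq_col M)).
pose r := nz_row (kermx M).
have nr : r != 0 by rewrite nz_row_eq0 kermx_eq0.
have rM : r *m M = 0 by apply/sub_kermxP/nz_row_sub.
pose F := \sum_i r 0 i *: 'X_[mono (enum_val i)] : {mpoly K[N]}.
have mono_inj : injective mono.
  move=> r1 r2 /mnmP E; apply/ffunP => u; apply/val_inj.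
  by have := E (val u); rewrite !mnmE valK.
have FE i : F@_(mono (enum_val i)) = r 0 i.
  rewrite raddf_sum (bigD1 i) //= mcoeffZ mcoeffX eqxx mulr1.
  rewrite big1 ?addr0 // => k ne; rewrite mcoeffZ mcoeffX.
  by rewrite (inj_eq mono_inj) (inj_eq enum_val_inj) (negbTE ne) mulr0.
exists F; split.
- have /rowP/existsNP[i /eqP] : r <> 0 by apply/eqP.
  by rewrite mxE -FE; apply: contraNneq => ->; rewrite mcoeff0.
- move=> m /msupp_sum_le /flattenP[s /mapP[i _ ->]] /msuppZ_le.
  rewrite msuppX inE => /eqP -> k kT; rewrite mnmE.
  by case: insubP => // u kT'; rewrite kT' in kT.
have deg_g i m : m \in msupp (g i) -> (mdeg m <= e)%N.
  move/msize_mdeg_lt/ltnW/leq_trans; apply.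
  by rewrite /e (bigD1 i) //= leq_addr.
pose bdeg b (G : S) := forall m, m \in msupp G -> (mdeg m <= b)%N.
have bdegM b1 b2 G1 G2 : bdeg b1 G1 -> bdeg b2 G2 -> bdeg (b1 + b2)%N (G1 * G2).
  move=> h1 h2 m /msuppM_le /allpairsP[[m1 m2] /= [/h1 ? /h2 ? ->]].
  by rewrite mdegD leq_add.
have bdeg1 : bdeg 0%N 1 by move=> m; rewrite msupp1 inE => /eqP ->;
  rewrite mdeg0.
have bdegX b G k : bdeg b G -> bdeg (k * b)%N (G ^+ k).
  by move=> h; elim: k => [|k IHk] //; rewrite exprS mulSn; apply: bdegM.
have bdeg_mono (m : 'X_{1..N}) : (forall i, (m i < D)%N) ->
    bdeg (N * (D.-1 * e))%N (mmap (@mpolyC n K) g 'X_[m]).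
  move=> ltD; rewrite mmapX /mmap1 -{1}[N]card_ord -sum1_card big_distrl /=.
  elim/big_ind2: _ => [//|G1 b1 G2 b2|i _]; first exact: bdegM.
  rewrite mul1n => m' /(bdegX e _ (m i) (@deg_g i)) /leq_trans; apply.
  by rewrite leq_mul2r; apply/orP; right; have := ltD i.
apply/mpolyP => m; rewrite mcoeff0.
have EF : mmap (@mpolyC n K) g F =
    \sum_i r 0 i *: mmap (@mpolyC n K) g 'X_[mono (enum_val i)].
  by rewrite raddf_sum; apply: eq_bigr => i _; rewrite /= mmapZ mul_mpolyC.
have [small|/forallPn[i0 big_i0]] := boolP [forall i, (m i < D * C)%N].
  pose c : colT := [ffun i => Ordinal (forallP small i)].
  have -> : m = comono c by apply/mnmP => i; rewrite mnmE ffunE.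
  have /rowP/(_ (enum_rank c)) := rM; rewrite !mxE => <-.
  rewrite EF raddf_sum; apply: eq_bigr => i _.
  by rewrite /= mcoeffZ mxE enum_rankK.
rewrite EF raddf_sum big1 // => i _;
  rewrite /= mcoeffZ memN_msupp_eq0 ?mulr0 //.
apply: contraNN big_i0 => /bdeg_mono h.
have ltD k : (mono (enum_val i) k < D)%N by rewrite mnmE; case: insubP.
have {h} := h ltD; rewrite mdegE (bigD1 i0) //= => h.
apply: leq_ltn_trans (leq_trans (leq_addr _ _) h) _.
rewrite mulnCA /C mulnS; apply: leq_ltn_trans (_ : D * (N * e) < _)%N.
  by rewrite leq_mul2r; apply/orP; right; apply: leqnSn.
by rewrite -[X in (X < _)%N]add0n ltn_add2r.
Qed.

(** Each step down the chain adds one independent element, and at the bottom there are at most [n].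
    The bound by [N] leaves slots of [g] for the new elements. *)
Lemma chain_bound (m : nat) (q : nat -> set S) (N : nat)
    (g : 'I_N -> S) (T : {set 'I_N}) :
  prime_chain m q -> alg_indep (q m) g T -> (m + #|T| <= N)%N ->
  (m + #|T| <= n)%N.
Proof.
elim: m g T => [|m IHm] g T [primeq ltq] ind le_N.
  rewrite add0n leqNgt; apply/negP => /(poly_many_dependent g)[F [F0 inF EF]].
  by case/eqP: F0; apply: ind inF _; rewrite EF; apply: ideal0; apply: primeq.
have [j jT] : exists j, j \notin T.
  have : (0 < #|~: T|)%N.
    by move: le_N (cardsC T); rewrite card_ord; clear; lia.
  by case/card_gt0P=> j; rewrite inE; exists j.
have [sub nsub] := ltq m (leqnn _).
have [f qf npf] : exists2 f, q m.+1 f & ~ q m f.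
  apply: contrapT => nex; apply: nsub => f qf; apply: contrapT => npf.
  by apply: nex; exists f.
have pm : is_prime_ideal (q m) by apply: primeq.
have pm1 : is_prime_ideal (q m.+1) by apply: primeq.
have chain_m : prime_chain m q.
  by split=> i hi; [apply: primeq | apply: ltq]; apply: ltnW.
have := IHm _ _ chain_m (alg_indep_add pm pm1 sub qf npf jT ind).
by rewrite cardsU1 jT addnCA add1n addSn; apply.
Qed.

End AlgebraicIndependence.

(** * Chains of primes below a kernel *)

Section SpecializationChain.

Variables (n : nat) (K E : fieldType) (pi : {rmorphism {mpoly K[n]} -> E}).
Local Notation S := {mpoly K[n]}.
Implicit Types (U T : {set 'I_n}) (F : S).

(** It interpolates between extension of scalars to [E], for empty [U], and [pi], for full [U]. *)
Definition partial_map U : S -> {mpoly E[n]} :=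
  mmap (@mpolyC n E \o (pi \o @mpolyC n K))
    (fun i => if i \in U then (pi 'X_i)%:MP else 'X_i).

HB.instance Definition _ U := GRing.RMorphism.on (partial_map U).

Lemma partial_mapC U c : partial_map U c%:MP = (pi c%:MP)%:MP.
Proof. exact: mmapC. Qed.

Lemma partial_mapX U i :
  partial_map U 'X_i = if i \in U then (pi 'X_i)%:MP else 'X_i.
Proof. by rewrite /partial_map mmapX mmap1U. Qed.

(* [partial_kernel U] is the ideal generated by the polynomials of the kernel
   of [pi] in the indeterminates from [U]. *)
Definition partial_kernel U : set S := [set F | partial_map U F = 0]%classic.

Lemma partial_kernel_prime U : is_prime_ideal (partial_kernel U).
Proof. exact: kernel_prime_ideal. Qed.

Lemma partial_map_in U F : poly_in U F -> partial_map U F = (pi F)%:MP.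
Proof.
move=> inF; rewrite /partial_map.
rewrite (@mmap_eq_in _ _ _ _ _ (fun i => (pi 'X_i)%:MP) U) //; last first.
  by move=> i /= ->.
rewrite [RHS](rmorph_mmap (@mpolyC n E \o pi : {rmorphism _ -> _})).
by [].
Qed.

Lemma partial_kernelT F : partial_kernel [set: 'I_n]%SET F <-> pi F = 0.
Proof.
rewrite /partial_kernel /= partial_map_in; last by move=> m _ i; rewrite inE.
by split=> [/eqP|->]; [rewrite mpolyC_eq0 => /eqP | rewrite mpolyC0].
Qed.

Lemma partial_kernelS U U' : U \subset U' ->
  (partial_kernel U `<=` partial_kernel U')%classic.
Proof.
move=> /fintype.subsetP sUU' F; rewrite /partial_kernel /= => F0.
(* The map for [U'] factors through the one for [U], by evaluation of the further variables. *)
pose ev : {mpoly E[n]} -> {mpoly E[n]} :=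
  mmap (@mpolyC n E) (fun i => if i \in U' then (pi 'X_i)%:MP else 'X_i).
suff <- : ev (partial_map U F) = partial_map U' F by rewrite F0 /ev raddf0.
rewrite [LHS](rmorph_mmap (ev \o partial_map U : {rmorphism _ -> _})).
rewrite [RHS](rmorph_mmap (partial_map U' : {rmorphism _ -> _})).
apply: eq_bigr => m _; congr (_ * _).
  by rewrite /= !partial_mapC /ev mmapC.
apply: eq_bigr => i _; congr (_ ^+ _); rewrite /= !partial_mapX.
by case: ifP => [/sUU' ->|_]; rewrite /ev ?mmapC // mmapX mmap1U.
Qed.

(** If [F] were in the smaller ideal, where ['X_j] stays free, [pi] would kill its coefficients in
    ['X_j], and these would vanish by the independence of [T]. *)
Lemma partial_kernel_proper T U j :
  (forall F, poly_in T F -> pi F = 0 -> F = 0) ->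
  T \subset U -> j \notin U ->
  (exists F, [/\ poly_in (j |: T) F, pi F = 0 & F <> 0]) ->
  (partial_kernel U `<` partial_kernel (j |: U))%classic.
Proof.
move=> ind sTU jU [F [inF piF F0]]; split.
  by apply: partial_kernelS; apply: finset.subsetUr.
move=> /(_ F); rewrite /partial_kernel /=.
rewrite partial_map_in; last by apply: poly_inS inF; apply: finset.setUS.
rewrite piF mpolyC0 => /(_ erefl).
rewrite /partial_map (mmap_coef_at j) (negbTE jU) => sum0.
apply: F0; apply: (@coef_at_eq0 _ _ j) => k.
have inC i : poly_in T (coef_at j i F) by apply: coef_at_in.
apply: ind => //.
have [lt_k|le_k] := ltnP k (msize F); last first.
  rewrite /coef_at big_seq_cond big1 ?raddf0 // =>
    m /andP[/msize_mdeg_lt lt_m /eqP Em].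
  move: lt_m; rewrite ltnNge (leq_trans le_k) // -Em mdegE (bigD1 j) //=.
  exact: leq_addr.
move/(congr1 (mcoeff (U_(j) *+ k)%MM)): sum0; rewrite mcoeff0 raddf_sum /=.
rewrite (bigD1 (Ordinal lt_k)) //= big1 ?addr0 => [|i ne].
  rewrite -/(partial_map U _) partial_map_in; last exact: poly_inS (inC k).
  by rewrite mcoeffCM mcoeffXn eqxx mulr1.
rewrite -/(partial_map U _) partial_map_in; last exact: poly_inS (inC i).
rewrite mcoeffCM mcoeffXn; case: eqP => [/mnmP/(_ j)|_]; last by rewrite mulr0.
rewrite !mulmnE mnm1E eqxx !mul1n => Ei; case/negP: ne.
by apply/eqP/val_inj.
Qed.

(** The variables outside [T] are added one at a time, and each satisfies a relation over [T]. *)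
Lemma maximal_independent_chain T :
  (forall F, poly_in T F -> pi F = 0 -> F = 0) ->
  (forall j, j \notin T ->
     exists F, [/\ poly_in (j |: T) F, pi F = 0 & F <> 0]) ->
  exists q, prime_chain (n - #|T|) q /\
    q (n - #|T|)%N = [set F | pi F = 0]%classic.
Proof.
move=> ind maxT; pose s := enum (~: T).
have size_s : size s = (n - #|T|)%N by rewrite -cardE cardsCs finset.setCK
  card_ord.
pose U k := [set i in take k s] :|: T.
exists (fun k => partial_kernel (U k)); split.
  split=> [i _|k lt_k]; first exact: partial_kernel_prime.
  rewrite -size_s in lt_k.
  have x0 : 'I_n by case: (s) lt_k.
  have jT : nth x0 s k \notin T by rewrite -finset.in_setC -mem_enum mem_nth.
  have -> : U k.+1 = nth x0 s k |: U k.
    apply/setP => i; rewrite /U (take_nth x0) // !inE mem_rcons inE.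
    by rewrite -!orbA.
  apply: partial_kernel_proper ind _ _ _; first exact: finset.subsetUr.
    rewrite !inE negb_or jT andbT.
    have := enum_uniq (mem (~: T));
      rewrite -/s -{1}(cat_take_drop k s) cat_uniq.
    rewrite (drop_nth x0 lt_k) => /and3P[_ + _] /=.
    by rewrite negb_or => /andP[].
  exact: maxT.
apply/seteqP; rewrite (_ : U _ = [set: 'I_n]%SET).
  by split=> F /partial_kernelT.
apply/setP => i; rewrite /U -size_s take_size !inE mem_enum !inE.
by rewrite orNb.
Qed.

End SpecializationChain.

Lemma truncate_chain (R : comNzRingType) (m k : nat) (q : nat -> set R) :
  (k <= m)%N -> prime_chain m q -> prime_chain k (fun i => q (m - k + i)%N).
Proof.
by move=> le_km [primeq ltq]; split=> i hi;
  [apply: primeq | rewrite addnS; apply: ltq]; lia.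
Qed.

(** * Toric parametrization of a set of cells *)

Section ToricParametrization.

(** The rectangle is glued from unit squares, first to a strip and then strip by strip; values at
    common corners are cancelled. *)
Lemma grid_rule (F : fieldType) (f : nat -> nat -> F) (A B : nat) :
  (forall a b, f a b != 0) ->
  (forall a b, (a < A)%N -> (b < B)%N ->
     f a b * f a.+1 b.+1 = f a b.+1 * f a.+1 b) ->
  f 0%N 0%N * f A B = f 0%N B * f A 0%N.
Proof.
move=> f0; elim: A => [|A IHA] H; first by rewrite mulrC.
have col : f A 0%N * f A.+1 B = f A B * f A.+1 0%N.
  have {}H b : (b < B)%N ->
    f A b * f A.+1 b.+1 = f A b.+1 * f A.+1 b by exact: H.
  elim: B H {IHA} => [|B IHB] H; first by rewrite mulrC.
  have E1 := H _ (leqnn _); have E2 : f A 0%N * f A.+1 B = f A B * f A.+1 0%N.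
    by apply: IHB => b hb; apply: H; apply: ltnW.
  apply: (mulfI (f0 A B)); apply: (mulfI (f0 A.+1 B)).
  transitivity ((f A 0%N * f A.+1 B) * (f A B * f A.+1 B.+1)); first by ring.
  by rewrite E1 E2; ring.
have E : f 0%N 0%N * f A B = f 0%N B * f A 0%N.
  by apply: IHA => a b ha hb; apply: H => //; apply: ltnW.
apply: (mulfI (f0 A B)); apply: (mulfI (f0 A 0%N)).
transitivity ((f 0%N 0%N * f A B) * (f A 0%N * f A.+1 B)); first by ring.
by rewrite E col; ring.
Qed.

Definition cell_rule (P : {fset cell}) (R : pzSemiRingType) (x : point -> R) :=
  forall c, c \in P ->
    x c * x (cell_ur c) = x (c.1, c.2 + 1) * x (c.1 + 1, c.2).

Lemma cell_rule_rectangle (P : {fset cell}) (F : fieldType) (x : point -> F) :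
  (forall v, x v != 0) -> cell_rule P x -> rectangle_rule P x.
Proof.
move=> x0 xP i k y l lt_ik lt_yl inP.
have [A EA] : exists A : nat, k = i + A%:Z by exists `|k - i|%N; clear -lt_ik;
  lia.
have [B EB] : exists B : nat, l = y + B%:Z by exists `|l - y|%N; clear -lt_yl;
  lia.
have := @grid_rule F (fun a b => x (i + a%:Z, y + b%:Z)) A B.
rewrite !addr0 -EA -EB; apply=> // a b ha hb.
have := xP (i + a%:Z, y + b%:Z); rewrite /cell_ur /= -!addrA.
have succ (t : nat) : t%:Z + 1 = t.+1%:Z by clear; lia.
rewrite !succ => -> //.
by apply: inP => /=; clear -ha hb EA EB; lia.
Qed.

(** The upper right corner of a cell with largest coordinate sum belongs to no other cell, so its
    value can be solved from the relation of that cell. *)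
Lemma toric_param (F : fieldType) (y : point -> F) (P : {fset cell}) :
  (forall v, y v != 0) ->
  exists x : point -> F, [/\ forall v, x v != 0,
    forall v, (forall c, c \in P -> v != cell_ur c) -> x v = y v &
    cell_rule P x].
Proof.
move=> y0; have [m] := ubnP #|` P|; elim: m P => // m IHm P le_m.
have [->|[c0 c0P]] := fset_0Vmem P.
  by exists y; split=> // c; rewrite inE.
have [N PN] := fset_bounded P.
have [||t [[a b] abP <-] maxt] :=
  @int_max (fun t => exists2 c, c \in P & c.1 + c.2 = t) (N + N) (c0.1 + c0.2).
- by exists c0.
- by move=> t [d /PN + <-]; case: d => d1 d2 /=; clear; lia.
have [|x [x0 xy xP]] := IHm (P `\ (a, b)).
  by move: le_m; rewrite (cardfsD1 (a, b)) abP.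
pose v0 : point := (a + 1, b + 1).
pose x' v := if v == v0 then x (a, b + 1) * x (a + 1, b) / x (a, b) else x v.
have x'E v : v != v0 -> x' v = x v by rewrite /x' => /negbTE ->.
exists x'; split.
- by move=> v; rewrite /x'; case: ifP => // _; rewrite !mulf_neq0 ?invr_eq0.
- move=> v nv; rewrite x'E ?nv //; last exact: nv abP.
  by apply: xy => c; rewrite in_fsetD1 => /andP[_ /nv].
move=> c cP; have := maxt (c.1 + c.2) (ex_intro2 _ _ c cP erefl).
case: c cP => c1 c2 cP /= le_ab.
have [E|ne] := eqVneq (c1, c2) (a, b).
  case: E => -> ->; rewrite /cell_ur /= (x'E (a, b)).
    rewrite (x'E (a, b + 1)).
      rewrite (x'E (a + 1, b)).
        by rewrite /x' eqxx mulrC divfK.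
      by rewrite xpair_eqE; clear; lia.
    by rewrite xpair_eqE; clear; lia.
  by rewrite xpair_eqE; clear; lia.
have xc := xP (c1, c2); rewrite in_fsetD1 ne cP /= in xc.
have n1 : (c1, c2) != v0 by rewrite xpair_eqE; clear -le_ab; lia.
have n2 : (c1 + 1, c2 + 1) != v0.
  by move: ne; rewrite !xpair_eqE; clear; lia.
have n3 : (c1, c2 + 1) != v0 by rewrite xpair_eqE; clear -le_ab; lia.
have n4 : (c1 + 1, c2) != v0 by rewrite xpair_eqE; clear -le_ab; lia.
by rewrite /cell_ur /= !x'E // xc.
Qed.

End ToricParametrization.

(** * Independent variables modulo a prime: a vanishing variable *)

Section PolyominoPrimes.

Variables (K : fieldType) (P : {fset cell}).
Local Notation n := #|{: vertices P}|.
Local Notation S := {mpoly K[n]}.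

Definition point_of (i : 'I_n) : point := val (enum_val i).

Lemma point_of_inj : injective point_of.
Proof. by move=> i j /val_inj/enum_val_inj. Qed.

Lemma point_ofP v : v \in vertices P -> exists i, point_of i = v.
Proof. by move=> vP; exists (enum_rank [` vP]);
  rewrite /point_of enum_rankK. Qed.

Lemma point_of_in i : point_of i \in vertices P.
Proof. exact: fsvalP. Qed.

(* 0 is a junk value outside of the vertices of [P]. *)
Definition value_at (E : fieldType) (f : {rmorphism S -> E}) (v : point) : E :=
  if insub v is Some u then f (x_ K (u : vertices P)) else 0.

Lemma value_at_point (E : fieldType) (f : {rmorphism S -> E}) i :
  value_at f (point_of i) = f 'X_i.
Proof. by rewrite /value_at /point_of valK /x_ enum_valK. Qed.

Lemma value_at_val (E : fieldType) (f : {rmorphism S -> E}) (u : vertices P) :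
  value_at f (val u) = f (x_ K u).
Proof. by rewrite /value_at valK. Qed.

Lemma cell_vertices_in c v :
  c \in P -> v \in cell_vertices c -> v \in vertices P.
Proof. by move=> cP vc; apply/bigfcupP; exists c; rewrite ?cP. Qed.

Lemma inner_itvE (i y k l : int) : inner_itv P (i, y) (k, l) <->
  [/\ i < k, y < l & forall c : cell, i <= c.1 < k -> y <= c.2 < l -> c \in P].
Proof.
rewrite /inner_itv /proper_itv /=; split.
  case=> /andP[lt_ik lt_yl] H; split=> // -[c1 c2] /= h1 h2; apply: H.
  by move=> [v1 v2]; rewrite !inE /=; clear -h1 h2; lia.
case=> lt_ik lt_yl H; split=> [|[c1 c2] sub]; first by rewrite lt_ik.
have := sub (c1, c2); have := sub (c1 + 1, c2 + 1); rewrite !inE /= => h1 h2.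
by apply: H => /=; clear -h1 h2; lia.
Qed.

Lemma rectangle_corners (i k y l : int) : i < k -> y < l ->
  (forall c : cell, i <= c.1 < k -> y <= c.2 < l -> c \in P) ->
  [/\ (i, y) \in vertices P, (k, l) \in vertices P,
      (i, l) \in vertices P & (k, y) \in vertices P].
Proof.
move=> lt_ik lt_yl inP.
have corner a b (v : point) : i <= a < k -> y <= b < l ->
    v \in cell_vertices (a, b) -> v \in vertices P.
  by move=> ha hb; apply: cell_vertices_in; apply: inP.
split.
- apply: (corner i y); rewrite ?in_cell_vertices /=; clear -lt_ik lt_yl; lia.
- apply: (corner (k - 1) (l - 1)); rewrite ?in_cell_vertices /=;
    clear -lt_ik lt_yl; lia.
- apply: (corner i (l - 1)); rewrite ?in_cell_vertices /=; clear -lt_ik lt_yl;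
  lia.
- apply: (corner (k - 1) y); rewrite ?in_cell_vertices /=; clear -lt_ik lt_yl;
  lia.
Qed.

Lemma polyomino_ideal_kernel (E : fieldType) (f : {rmorphism S -> E}) :
  (polyomino_ideal K P `<=` [set F | f F = 0])%classic <->
  rectangle_rule P (value_at f).
Proof.
split=> [sub i k y l lt_ik lt_yl inP|rule _ [s [inG ->]]].
  have [ay kl il ky] := rectangle_corners lt_ik lt_yl inP.
  have := sub (x_ K [` ay] * x_ K [` kl] - x_ K [` il] * x_ K [` ky]).
  rewrite /= rmorphB !rmorphM -!value_at_val /= => H; apply/eqP.
  rewrite -subr_eq0 H //;
    exists [:: (1, x_ K [` ay] * x_ K [` kl] - x_ K [` il] * x_ K [` ky])].
  split; last by rewrite big_seq1 mul1r.
  move=> _ /[!inE] /eqP -> /=; exists [` ay], [` kl], [` il], [` ky].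
  by split=> //=; apply/inner_itvE.
rewrite /= rmorph_sum big_seq big1 // =>
  -[r _] /inG /= [a [b [c [d [ab Ec Ed ->]]]]].
rewrite rmorphM rmorphB !rmorphM -!value_at_val Ec Ed.
move: ab; case: (val a) (val b) => [a1 a2] [b1 b2] /inner_itvE[h1 h2 h3].
by rewrite /= rule // subrr mulr0.
Qed.

Definition independent (E : fieldType) (f : {rmorphism S -> E})
    (T : {set 'I_n}) :=
  forall F : S, poly_in T F -> f F = 0 -> F = 0.

Section IndependentBound.

Variables (E : fieldType) (f : {rmorphism S -> E}) (T : {set 'I_n}).
Hypotheses (rule : rectangle_rule P (value_at f)) (indT : independent f T).

Lemma independent_neq0 i : i \in T -> f 'X_i != 0.
Proof.
move=> iT; apply/eqP => fi0; have : 'X_i = 0 :> S.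
  apply: indT => // m; rewrite msuppX inE => /eqP -> j jT; rewrite mnm1E.
  by case: eqP => // E1; rewrite -E1 iT in jT.
by move/(congr1 (mcoeff U_(i)))/eqP; rewrite mcoeffX eqxx mcoeff0 oner_eq0.
Qed.

Lemma independent_monomials (m1 m2 : 'X_{1..n}) :
  (forall i, i \notin T -> m1 i = 0%N /\ m2 i = 0%N) ->
  f 'X_[m1] = f 'X_[m2] -> m1 = m2.
Proof.
move=> mT Ef; have : 'X_[m1] - 'X_[m2] = 0 :> S.
  apply: indT; last by rewrite rmorphB Ef subrr.
  move=> m /msuppB_le; rewrite !msuppX !inE => /orP[] /eqP -> i iT.
    by have [] := mT i iT.
  by have [] := mT i iT.
move/(congr1 (mcoeff m1)); rewrite mcoeffB !mcoeffX eqxx mcoeff0.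
by case: eqP => // _ /eqP; rewrite subr0 oner_eq0.
Qed.

Let U : {fset point} := [fset point_of i | i in T].

Let U_card : #|` U| = #|T|.
Proof. by rewrite card_imfset ?cardE //; apply: point_of_inj. Qed.

Let U_sub : U `<=` vertices P.
Proof. by apply/fsubsetP => _ /imfsetP[i _ ->]; apply: point_of_in. Qed.

Let vertices_card : #|` vertices P| = n.
Proof. by rewrite -cardfE. Qed.

Let value_U_neq0 v : v \in U -> value_at f v != 0.
Proof. by case/imfsetP=> i /= iT ->;
  rewrite value_at_point independent_neq0. Qed.

(** If [T] were larger, an alternating walk in [Q] with corners in [U] and [z] would exist, and its
    balance contradicts the independence of [T]. *)
Lemma independent_bound_zero (A : cell) i0 :
  A \in P -> acyclic (P `\ A) -> f 'X_i0 = 0 -> (#|T| + #|` P| <= n)%N.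
Proof.
move=> AP aQ fi0; rewrite leqNgt; apply/negP => lt_n.
set Q := P `\ A in aQ; pose z := point_of i0.
have i0T : i0 \notin T by apply: contra_eqN fi0 => /independent_neq0.
have zU : z \notin U.
  by apply/imfsetP => -[i /= iT /point_of_inj E1]; rewrite E1 iT in i0T.
have fz : value_at f z = 0 by rewrite value_at_point.
(* The point [z] makes up for the removed cell: one condition fewer for one weight fewer. *)
have card_lt : (#|` vertices Q `\` (z |` U)| < #|` Q|)%N.
  apply: leq_ltn_trans (_ : #|` vertices P `\` (z |` U)| < _)%N.
    apply/fsubset_leq_card/fsetSD/fsubsetP => v /bigfcupP[c].
    by rewrite andbT in_fsetD1 => /andP[_ cP] vc; apply: cell_vertices_in vc.
  have sub : z |` U `<=` vertices P.
    by rewrite fsubUset U_sub fsub1set point_of_in.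
  move: (fsubset_leq_card sub) lt_n;
    rewrite cardfsDS // cardfsU1 zU U_card vertices_card.
  rewrite (cardfsD1 A P) AP -/Q; clear; lia.
have [w [wQ [c wc] w0]] := @corner_sum_kernel rat _ _ card_lt.
have [s [s0 ws sgn]] := alternating_walk wQ wc.
have ruleQ : rectangle_rule Q (value_at f).
  move=> i k y l h1 h2 h3; apply: rule => // d /h3 H /H.
  by rewrite in_fsetD1 => /andP[].
have bal := closed_walk_balanced ruleQ (fun s c => acyclic_winding aQ) ws.
have inU v : corner_sum w v != 0 -> v \in z |` U.
  by move=> nv; apply: contraNT nv => /w0 ->.
have prod_neq0 (g : point * point -> point) :
    (forall e, e \in s -> g e \in U) -> \prod_(e <- s) value_at f (g e) != 0.
  by move=> gU; rewrite prodf_seq_neq0; apply/allP => e /gU /value_U_neq0.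
have prod_eq0 (g : point * point -> point) e :
    e \in s -> g e = z -> \prod_(e <- s) value_at f (g e) = 0.
  by move=> se ge; apply/eqP; rewrite prodf_seq_eq0; apply/hasP; exists e;
    rewrite // ge fz /=.
have in1 e : e \in s -> e.1 != z -> e.1 \in U.
  move=> /sgn[h _] ne; have := inU e.1; rewrite gt_eqF // in_fset1U (negbTE ne).
  exact.
have in2 e : e \in s -> e.2 != z -> e.2 \in U.
  move=> /sgn[_ h] ne; have := inU e.2; rewrite lt_eqF // in_fset1U (negbTE ne).
  exact.
have ne12 e e' : e \in s -> e' \in s -> e.1 != e'.2.
  move=> /sgn[h _] /sgn[_ h']; apply: contraTneq h => ->.
  by rewrite -leNgt ltW.
(* By the signs, [z] occurs on one side of the balance at most. There the product vanishes, while
   the factors on the other side are nonzero. *)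
have [/hasP[e se /eqP ez]|/hasPn nz1] := boolP (has (fun e => e.1 == z) s).
  have /eqP := bal; rewrite (prod_eq0 _ e) // eq_sym; apply/negP/prod_neq0.
  by move=> e' se'; apply: in2 => //; rewrite -ez eq_sym ne12.
have [/hasP[e se /eqP ez]|/hasPn nz2] := boolP (has (fun e => e.2 == z) s).
  by have /eqP := bal; rewrite (prod_eq0 snd e) //;
    apply/negP/prod_neq0 => e' se'; apply: in1 => //; rewrite -ez ne12.
pose idx v := odflt i0 [pick i | point_of i == v].
have idxE v : v \in U -> point_of (idx v) = v /\ idx v \in T.
  case/imfsetP=> i /= iT ->; rewrite /idx;
    case: pickP => [j /eqP/point_of_inj -> //|].
  by move/(_ i); rewrite eqxx.
have U1 e : e \in s -> e.1 \in U by move=> se; apply: in1 (nz1 e se).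
have U2 e : e \in s -> e.2 \in U by move=> se; apply: in2 (nz2 e se).
have valX (g : point * point -> point) : (forall e, e \in s -> g e \in U) ->
    f 'X_[\sum_(e <- s) U_(idx (g e))]%MM = \prod_(e <- s) value_at f (g e).
  move=> gU; rewrite (big_morph _ (@mpolyXD _ _) (mpolyX0 _ _)) rmorph_prod.
  rewrite big_seq [RHS]big_seq; apply: eq_bigr => e /gU/idxE[E1 _].
  by rewrite -[in RHS]E1 value_at_point.
have : (\sum_(e <- s) U_(idx e.1) = \sum_(e <- s) U_(idx e.2))%MM.
  apply: independent_monomials; last by rewrite (valX fst) // (valX snd).
  move=> i iT; rewrite !mnm_sumE; split; rewrite big_seq big1 // => e se;
    rewrite mnm1E; case: eqP => // E1; case/negP: iT; rewrite -E1.
    by have [] := idxE _ (U1 e se).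
  by have [] := idxE _ (U2 e se).
(* The two monomials are equal, but the variable of [e0.1] cannot occur in the second one, again by
   the signs. *)
case: (s) s0 U1 U2 ne12 => // e0 s' _ V1 V2 ne.
have e0s : e0 \in e0 :: s' by rewrite mem_head.
have [P1 _] := idxE _ (V1 _ e0s).
move/mnmP/(_ (idx e0.1)); rewrite !mnm_sumE big_cons mnm1E eqxx => E1.
suff : (\sum_(e <- e0 :: s') U_(idx e.2)%MM (idx e0.1) = 0)%N by rewrite -E1.
rewrite big_seq big1 // => e se; rewrite mnm1E; case: eqP => // E2.
have := ne e0 e e0s se; have [P2 _] := idxE _ (V2 _ se).
by rewrite -P1 -P2 E2 eqxx.
Qed.

End IndependentBound.
End PolyominoPrimes.

(** * Independent variables modulo a prime: no vanishing variable *)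

Lemma common_denominator (T : eqType) (w : T -> rat) (s : seq T) :
  exists2 d : int, d != 0 &
    forall c, c \in s -> exists z : int, d%:~R * w c = z%:~R.
Proof.
elim: s => [|a s [d d0 dw]]; first by exists 1.
exists (d * denq (w a)); first by rewrite mulf_neq0 ?denq_neq0.
move=> c; rewrite inE intrM => /predU1P[->|/dw[z Ez]].
  by exists (d * numq (w a)); rewrite intrM -mulrA numqE [X in _ * X]mulrC.
by exists (z * denq (w a)); rewrite mulrAC Ez intrM.
Qed.

Lemma prod_translate (F : fieldType) (x : point -> F) (z : cell -> int)
    (P : {fset cell}) (s : seq point) (tau sigma : point -> point) :
  (forall c, c \notin P -> z c = 0) ->
  cancel tau sigma -> cancel sigma tau -> uniq s ->
  (forall c, c \in P -> tau c \in s) ->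
  \prod_(v <- s) x v ^ z (sigma v) = \prod_(c <- P) x (tau c) ^ z c.
Proof.
move=> zP tauK sigmaK uniq_s tau_s.
transitivity (\prod_(v <- [seq tau c | c <- P]) x v ^ z (sigma v)); last first.
  by rewrite big_map; apply: eq_bigr => c _; rewrite tauK.
rewrite (bigID (fun v => sigma v \in P)) /= [X in _ * X]big1 ?mulr1; last first.
  by move=> v /zP ->; rewrite expr0z.
rewrite -big_filter; apply/perm_big/uniq_perm.
- exact: filter_uniq.
- by rewrite map_inj_uniq ?fset_uniq //; apply: can_inj tauK.
move=> v; rewrite mem_filter; apply/andP/mapP.
  by case=> vP _; exists (sigma v).
by case=> c cP ->; rewrite tauK; split=> //; apply: tau_s.
Qed.

Section HeightOfPolyominoIdeal.

Variables (K : fieldType) (P : {fset cell}).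
Local Notation n := #|{: vertices P}|.
Local Notation S := {mpoly K[n]}.

(** Regrouped by cells, the product consists of the [z c]-th powers of the quotients of diagonal by
    anti-diagonal products, all equal to 1. *)
Lemma lattice_relation (E : fieldType) (f : {rmorphism S -> E})
    (z : cell -> int) :
  rectangle_rule P (value_at f) -> (forall i, f 'X_i != 0) ->
  (forall c, c \notin P -> z c = 0) ->
  \prod_i f 'X_i ^ (z ((point_of i).1 - 1, (point_of i).2 - 1) + z (point_of i)
    - z ((point_of i).1 - 1, (point_of i).2)
    - z ((point_of i).1, (point_of i).2 - 1)) = 1.
Proof.
move=> rule f0 zP; pose x := value_at f.
pose s := [seq point_of (P := P) i | i <- index_enum 'I_n].
have x0 v : v \in s -> x v != 0.
  by case/mapP=> i _ ->; rewrite /x value_at_point.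
have uniq_s : uniq s.
  by rewrite map_inj_uniq ?index_enum_uniq //; apply: point_of_inj.
have mem_s c v : c \in P -> v \in cell_vertices c -> v \in s.
  move=> cP vc; have [i <-] := point_ofP (cell_vertices_in cP vc).
  by apply: map_f; rewrite mem_index_enum.
transitivity (\prod_(v <- s) x v ^ (z (v.1 - 1, v.2 - 1) + z v
    - z (v.1 - 1, v.2) - z (v.1, v.2 - 1))).
  by rewrite big_map; apply: eq_bigr => i _; rewrite /x value_at_point.
transitivity (\prod_(v <- s) (x v ^ z (v.1 - 1, v.2 - 1) * x v ^ z v
    * x v ^ (- z (v.1 - 1, v.2)) * x v ^ (- z (v.1, v.2 - 1)))).
  rewrite big_seq [RHS]big_seq; apply: eq_bigr => v /x0 v0.
  by rewrite -!expfzDr.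
have zP' c : c \notin P -> - z c = 0 by move=> /zP ->; rewrite oppr0.
rewrite !big_split /=.
rewrite (prod_translate x (sigma := fun v => (v.1 - 1, v.2 - 1))
  (tau := fun c => (c.1 + 1, c.2 + 1)) zP) //; first last.
- by move=> [a b] cP; apply: (mem_s _ _ cP); rewrite in_cell_vertices /=;
  clear; lia.
- by move=> [a b] /=; rewrite !subrK.
- by move=> [a b] /=; rewrite !addrK.
rewrite (prod_translate x (sigma := id) (tau := id) zP) //; last first.
  by move=> [a b] cP; apply: (mem_s _ _ cP); rewrite in_cell_vertices /=;
    clear; lia.
rewrite (prod_translate x (sigma := fun v => (v.1 - 1, v.2))
  (tau := fun c => (c.1 + 1, c.2)) zP') //; first last.
- by move=> [a b] cP; apply: (mem_s _ _ cP); rewrite in_cell_vertices /=;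
  clear; lia.
- by move=> [a b] /=; rewrite !subrK.
- by move=> [a b] /=; rewrite !addrK.
rewrite (prod_translate x (sigma := fun v => (v.1, v.2 - 1))
  (tau := fun c => (c.1, c.2 + 1)) zP') //; first last.
- by move=> [a b] cP; apply: (mem_s _ _ cP); rewrite in_cell_vertices /=;
  clear; lia.
- by move=> [a b] /=; rewrite !subrK.
- by move=> [a b] /=; rewrite !addrK.
rewrite -!big_split /= big_seq big1 // => -[a b] cP.
have in_s (v : point) : v \in cell_vertices (a, b) -> x v != 0.
  by move=> vc; apply/x0/(mem_s _ _ cP).
have -> : x (a + 1, b + 1) ^ z (a, b) * x (a, b) ^ z (a, b) =
    (x (a, b + 1) * x (a + 1, b)) ^ z (a, b).
  rewrite -expfzMl mulrC /x rule // => [||[c d] /= h1 h2].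
  - by clear; lia.
  - by clear; lia.
  by rewrite (_ : (c, d) = (a, b)) //; congr (_, _); clear -h1 h2; lia.
have x1 : x (a, b + 1) != 0 by apply: in_s; rewrite in_cell_vertices /=;
  clear; lia.
have x2 : x (a + 1, b) != 0 by apply: in_s; rewrite in_cell_vertices /=;
  clear; lia.
by rewrite expfzMl -!invr_expz /= mulfK ?mulfV ?expfz_neq0.
Qed.

Lemma independent_bound_torus (E : fieldType) (f : {rmorphism S -> E})
    (T : {set 'I_n}) :
  rectangle_rule P (value_at f) -> independent f T -> (forall i, f 'X_i != 0) ->
  (#|T| + #|` P| <= n)%N.
Proof.
move=> rule indT f0; rewrite leqNgt; apply/negP => lt_n.
pose U : {fset point} := [fset point_of i | i in T].
have card_lt : (#|` vertices P `\` U| < #|` P|)%N.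
  have sub : U `<=` vertices P.
    by apply/fsubsetP => _ /imfsetP[i _ ->]; apply: point_of_in.
  have cU : #|` U| = #|T| by rewrite card_imfset ?cardE //; apply: point_of_inj.
  have cV : #|` vertices P| = n by rewrite -cardfE.
  move: (fsubset_leq_card sub) lt_n; rewrite cardfsDS // cU cV; clear; lia.
have [w [wP [c wc] w0]] := @corner_sum_kernel rat _ _ card_lt.
have [d d0 dw] := common_denominator w P.
have /choice[z Ez] : forall c, exists z : int, d%:~R * w c = z%:~R.
  move=> c'; have [/dw//|/wP ->] := boolP (c' \in P).
  by exists 0; rewrite mulr0.
have zP c' : c' \notin P -> z c' = 0.
  move=> /wP E0; apply/eqP; rewrite -(intr_eq0 rat) -Ez E0 mulr0.
  by [].
pose u i : int := z ((point_of (P := P) i).1 - 1, (point_of i).2 - 1)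
    + z (point_of i)
    - z ((point_of i).1 - 1, (point_of i).2)
    - z ((point_of i).1, (point_of i).2 - 1).
have Eu i : (u i)%:~R = d%:~R * corner_sum w (point_of i).
  by rewrite /u /corner_sum !(rmorphB, rmorphD) /= -!Ez; ring.
have uT i : i \notin T -> u i = 0.
  move=> iT; apply/eqP; rewrite -(intr_eq0 rat) Eu w0 ?mulr0 //.
  by apply: contra iT => /imfsetP[j /= jT /point_of_inj ->].
(* The positive and negative parts of the exponent vector [u], which is supported on [T]. *)
pose m1 := [multinom (if (0 <= u i)%R then `|u i|%N else 0%N) | i < n].
pose m2 := [multinom (if (0 <= u i)%R then 0%N else `|u i|%N) | i < n].
have Em : m1 = m2.
  apply: (independent_monomials indT).
    by move=> i /uT ui; rewrite !mnmE ui.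
  rewrite -[RHS]mul1r -(lattice_relation rule f0 zP).
  rewrite !mpolyXE_id !rmorph_prod -big_split /=; apply: eq_bigr => i _.
  rewrite -/(u i) !rmorphXn /= !mnmE; case: (u i) => k /=.
    by rewrite expr0 mulr1.
  by rewrite expr0 NegzE /= -exprnN -[RHS]/(_ ^- _ * _ ^+ _) mulVf // expf_neq0.
have [v nv] := corner_sum_neq0 wP wc.
have [i Ei] := point_ofP (corner_sum_vertices wP nv).
have ui : u i == 0.
  by move/mnmP/(_ i): Em; rewrite !mnmE; clear; case: ifP; lia.
move: ui; rewrite -(intr_eq0 rat) Eu Ei mulf_eq0 intr_eq0 (negbTE d0).
by rewrite (negbTE nv).
Qed.

End HeightOfPolyominoIdeal.

(** * Height of the ideal *)

Section Height.

Variables (K : fieldType) (P : {fset cell}) (A : cell).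
Hypotheses (AP : A \in P) (acyclicPA : acyclic (P `\ A)).
Local Notation n := #|{: vertices P}|.
Local Notation S := {mpoly K[n]}.

Lemma independent0 (E : fieldType) (f : {rmorphism S -> E}) :
  independent f finset.set0.
Proof.
move=> F inF fF; have EF : F = (F@_0%MM)%:MP.
  apply/mpolyP => m; rewrite mcoeffC; case: eqP => [->|m0];
    first by rewrite mulr1.
  rewrite mulr0 memN_msupp_eq0 //; apply/negP => /inF H; apply: m0.
  by apply/mnmP => i; rewrite mnm0E H // inE.
move: fF; rewrite EF => /eqP.
rewrite (fmorph_eq0 (f \o @mpolyC n K : {rmorphism K -> E})) => /eqP ->.
by rewrite mpolyC0.
Qed.

(** A largest independent set [T] yields a chain of [n - #|T|] steps ending in [p]; the bounds on
    [T] make it long enough, and its top part is kept. *)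
Lemma chain_to_prime (p : set (polyomino_ring K P)) :
  is_prime_ideal p -> (polyomino_ideal K P `<=` p)%classic ->
  exists q, prime_chain #|` P| q /\ q #|` P| = p.
Proof.
move=> prime_p sIp; have [E [f kerf]] := prime_ideal_kernel prime_p.
have Ep : p = [set F | f F = 0]%classic by apply/seteqP; split=> F /kerf.
have rule : rectangle_rule P (value_at (f : {rmorphism S -> E})).
  by apply/polyomino_ideal_kernel; rewrite -Ep.
pose ind (T : {set 'I_n}) := `[< independent (f : {rmorphism S -> E}) T >].
have ind0 : ind finset.set0 by apply/asboolP/independent0.
case: (arg_maxnP (fun T : {set 'I_n} => #|T|) ind0) => T /asboolP indT maxT.
have leT : (#|T| + #|` P| <= n)%N.
  have [[i fi0]|nex] := pselect (exists i, f ('X_i : S) = 0).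
    exact: (independent_bound_zero rule indT AP acyclicPA fi0).
  apply: (independent_bound_torus rule indT) => i.
  by apply/eqP => fi0; apply: nex; exists i.
have [|q [chain_q Eq]] := maximal_independent_chain indT.
  move=> j jT; apply: contrapT => nex.
  have : ind (j |: T).
    apply/asboolP => F inF fF; apply: contrapT => F0; apply: nex.
    by exists F.
  by move/maxT; rewrite /geq /= cardsU1 jT ltnn.
have le_k : (#|` P| <= n - #|T|)%N by move: leT; clear; lia.
exists (fun i => q (n - #|T| - #|` P| + i)%N); split.
  exact: truncate_chain.
by rewrite subnK // Eq Ep.
Qed.

(** The value 1 off the vertices is a default, nonzero as [toric_param] requires. *)
Let y (v : point) : {fraction S} :=
  if insub v is Some u then
    FracField.tofrac 'X_(enum_rank (u : vertices P))
  else 1.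

Let y_neq0 v : y v != 0.
Proof.
rewrite /y; case: insub => [u|]; last exact: oner_neq0.
rewrite tofrac_eq0 -msupp_eq0 msuppX.
by [].
Qed.

(** The variables away from the upper right corners of cells keep their values under the
    parametrization, so they are independent modulo its kernel, and [chain_bound] applies. *)
Lemma toric_prime :
  exists p : set (polyomino_ring K P), [/\ is_prime_ideal p,
    (polyomino_ideal K P `<=` p)%classic &
    forall m q, prime_chain m q -> q m = p -> (m <= #|` P|)%N].
Proof.
have [x [x0 xy xP]] := toric_param P y_neq0.
pose Phi : {rmorphism S -> {fraction S}} :=
  mmap (@FracField.tofrac S \o @mpolyC n K) (fun i => x (point_of i)).
exists [set F | Phi F = 0]%classic; split; first exact: kernel_prime_ideal.
  apply/polyomino_ideal_kernel.
  have rx := cell_rule_rectangle x0 xP.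
  have Ex v : v \in vertices P -> value_at Phi v = x v.
    by move=> /point_ofP[i <-]; rewrite value_at_point /Phi /= mmapX mmap1U.
  move=> i k b l lt_ik lt_bl inP.
  have [h1 h2 h3 h4] := rectangle_corners lt_ik lt_bl inP.
  by rewrite !Ex //; apply: rx.
move=> m q chain_q Eq.
pose T := [set i | point_of (P := P) i \notin [fset cell_ur c | c in P]].
(* The last [m] slots, filled with 0, are room for the elements found along the chain. *)
pose g (i : 'I_(n + m)) : S := if split i is inl j then 'X_j else 0.
pose T' := [set lshift m i | i in T].
have cT : (n - #|` P| <= #|T|)%N.
  have : (#|~: T| <= #|` P|)%N.
    have <- : #|` [fset point_of (P := P) i | i in ~: T]| = #|~: T|.
      by rewrite card_imfset ?cardE //; apply: point_of_inj.
    apply: leq_trans (_ : #|` [fset cell_ur c | c in P]| <= _)%N.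
      apply/fsubset_leq_card/fsubsetP => _ /imfsetP[i /= + ->].
      by rewrite !inE negbK.
    by rewrite (leq_trans (leq_imfset_card _ _ _)).
  by have := cardsC T; rewrite card_ord; clear; lia.
have g_lshift i : g (lshift m i) = 'X_i by rewrite /g (unsplitK (inl i)).
have cT' : #|T'| = #|T| by rewrite card_imset //; apply: lshift_inj.
have ind : alg_indep (q m) g T'.
  rewrite Eq => F inF /= PhiF.
  (* On the variables of [T'], [Phi] after [psi] is the embedding into fractions after [psi], and
     [lam] inverts [psi]. *)
  pose psi : {rmorphism {mpoly K[n + m]} -> S} := mmap (@mpolyC n K) g.
  pose lam : {rmorphism S -> {mpoly K[n + m]}} :=
    mmap (@mpolyC (n + m) K) (fun i => 'X_(lshift m i)).
  have psi0 : psi F = 0.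
    apply/eqP; rewrite -tofrac_eq0 -PhiF -/(psi F); apply/eqP.
    rewrite [RHS](rmorph_mmap (Phi \o psi : {rmorphism _ -> _})).
    rewrite [LHS](rmorph_mmap (@FracField.tofrac S \o psi :
      {rmorphism _ -> _})).
    transitivity (mmap ((Phi \o psi : {rmorphism _ -> _}) \o @mpolyC (n + m) K)
        (fun i => FracField.tofrac (psi 'X_i)) F).
      apply: eq_bigr => mon _; congr (_ * _).
      by rewrite /= /psi /= mmapC /Phi /= mmapC.
    apply: mmap_eq_in inF _ => _ /imsetP[i iT ->] /=.
    rewrite /psi /= mmapX mmap1U g_lshift /Phi /= mmapX mmap1U xy.
      by rewrite /y /point_of valK enum_valK.
    move=> c cP; move: iT; rewrite inE; apply: contraNneq => ->.
    by apply/imfsetP; exists c.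
  rewrite -[RHS](rmorph0 lam) -psi0.
  rewrite [RHS](rmorph_mmap (lam \o psi : {rmorphism _ -> _})).
  rewrite [LHS](rmorph_mmap (idfun : {rmorphism {mpoly K[n + m]} -> _})).
  transitivity (mmap ((lam \o psi : {rmorphism _ -> _}) \o @mpolyC (n + m) K)
      (fun i => 'X_i) F).
    apply: eq_bigr => mon _; congr (_ * _).
    by rewrite /= /psi /= mmapC /lam /= mmapC.
  apply: mmap_eq_in inF _ => _ /imsetP[i iT ->] /=.
  by rewrite /psi /= mmapX mmap1U g_lshift /lam /= mmapX mmap1U.
have := chain_bound chain_q ind; rewrite cT' => /(_ _).
have leT : (#|T| <= n)%N by rewrite -[X in (_ <= X)%N]card_ord max_card.
by move: cT leT; clear; lia.
Qed.

Lemma height_polyomino_ideal : has_height (polyomino_ideal K P) #|` P|.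
Proof.
have [p [prime_p sIp bound_p]] := toric_prime.
split.
  exists p; split=> //; split=> //.
  exact: chain_to_prime.
move=> p' m prime_p' sIp' [_ bound_p'].
have [q [chain_q Eq]] := chain_to_prime prime_p' sIp'.
exact: bound_p' chain_q Eq.
Qed.

End Height.

Theorem proposition4p10 (K : fieldType) (P : {fset cell}) (hP : is_polyomino P) :
  ((exists2 A : cell, A \in P & is_simple (P `\ A)) ->
     has_height (polyomino_ideal K P) #|` P|)
  /\ (is_closed_path P -> has_height (polyomino_ideal K P) #|` P|).
Proof.
split=> [[A AP /simple_acyclic aPA]|/closed_path_acyclic[A AP aPA]].
  exact: height_polyomino_ideal AP aPA.
exact: height_polyomino_ideal AP aPA.
Qed.
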